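(* Let $p\in\mathbb{C}[z]$ be a polynomial of degree $n\geq 3$ with only simple zeros and let $D_p=\{(x,y,z)\in\mathbb{C}^3 : xy=p(z)\}$ with its standard volume form $\omega$. Then the Lie algebra generated by the holomorphic shear fields on $D_p$ is not dense (with respect to the compact-open topology) in the Lie algebra of holomorphic volume preserving vector fields on $D_p$.
   Context: The volume form $\omega$ is the nowhere vanishing algebraic 2-form on the smooth surface $D_p$ given by $\omega=\frac{dx}{x}\wedge dz$ where $x\neq0$ and $\omega=-\frac{dy}{y}\wedge dz$ where $y\neq 0$. A holomorphic vector field $\Theta$ is volume preserving if $L_\Theta\omega=0$. Holomorphic shear fields are the vector fields $g(x)\left(p'(z)\frac{\partial}{\partial y}+x\frac{\partial}{\partial z}\right)$ and $g(y)\left(p'(z)\frac{\partial}{\partial x}+y\frac{\partial}{\partial z}\right)$ with $g$ an entire function of one variable. The compact-open topology is that of uniform convergence on compact subsets. *)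

(* Defs.v *)
From HB Require Import structures.
From mathcomp Require Import all_boot all_order all_algebra complex.
From mathcomp Require Import all_classical all_reals all_analysis.

Set Implicit Arguments.
Unset Strict Implicit.
Unset Printing Implicit Defensive.

Import Order.TTheory GRing.Theory Num.Theory.
Import numFieldNormedType.Exports.

Local Open Scope classical_set_scope.
Local Open Scope ring_scope.

(* The complex numbers as a numClosedFieldType, so that C R and 'rV[C R]_3
   carry the normed module structures (with scalars C R) of the library. In
   particular [differentiable] and ['d] below are complex differentiability and
   the complex differential. *)
Definition C (R : realType) : numClosedFieldType := R[i].

(* The coordinates (x, y, z) of a point of, or a vector in, C^3. *)
Definition xc (K : Type) (v : 'rV[K]_3) : K := v 0 0.
Definition yc (K : Type) (v : 'rV[K]_3) : K := v 0 1.
Definition zc (K : Type) (v : 'rV[K]_3) : K := v 0 2.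

Definition vec3 (K : Type) (a b c : K) : 'rV[K]_3 :=
  \row_(j < 3) nth c [:: a; b] j.

Section Submanifold.
Variables (R : realType) (D : set 'rV[C R]_3).

(* Holomorphic maps on a closed complex submanifold D of C^3: locally
   restrictions of holomorphic maps on open subsets of C^3. *)
Definition local_extension (W : normedModType (C R)) (F : D -> W) (q : D) :
    set ('rV[C R]_3 -> W) :=
  [set G | (\forall x \near set_val q, differentiable G x) /\
           (\forall r \near q, F r = G (set_val r))].

Definition holomorphic_at (W : normedModType (C R)) (F : D -> W) (q : D) :=
  exists G, local_extension F q G.

(* The derivative of F at q in the direction v: for F holomorphic at q and v
   tangent to D at q it does not depend on the chosen local extension. *)
Definition tderive (W : normedModType (C R)) (F : D -> W) (q : D)
    (v : 'rV[C R]_3) : W :=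
  'd (xget (fun=> 0) (local_extension F q)) (set_val q) v.

Definition Lie_bracket (V W : D -> 'rV[C R]_3) : D -> 'rV[C R]_3 :=
  fun q => tderive W q (V q) - tderive V q (W q).

Definition Lie_closed (g : set (D -> 'rV[C R]_3)) : Prop :=
  [/\ g (fun=> 0),
      forall V W, g V -> g W -> g (fun q => V q + W q),
      forall (a : C R) V, g V -> g (fun q => a *: V q) &
      forall V W, g V -> g W -> g (Lie_bracket V W)].

Definition Lie_generated (S : set (D -> 'rV[C R]_3)) :
    set (D -> 'rV[C R]_3) :=
  smallest Lie_closed S.

(* Density of A in B for the topology of uniform convergence on compact
   subsets of D (which carries the topology induced by C^3). *)
Definition co_dense (A B : set (D -> 'rV[C R]_3)) : Prop :=
  B `<=` closure (A : set {family compact, D -> 'rV[C R]_3}).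

End Submanifold.

Section Danielewski.
Variables (R : realType) (p : {poly C R}).

Definition Dsurf : set 'rV[C R]_3 := [set q | xc q * yc q = p.[zc q]].

(* v lies in the tangent space at q, the kernel of d(xy - p(z)). *)
Definition tangent (q v : 'rV[C R]_3) : Prop :=
  yc q * xc v + xc q * yc v = p^`().[zc q] * zc v.

Definition holo_vfield_at (V : Dsurf -> 'rV[C R]_3) (q : Dsurf) : Prop :=
  holomorphic_at V q /\ \forall r \near q, tangent (set_val r) (V r).

Definition holo_vfield (V : Dsurf -> 'rV[C R]_3) : Prop :=
  forall q, holo_vfield_at V q.

(* The volume form on pairs of tangent vectors: dx/x /\ dz where x <> 0 and
   - dy/y /\ dz where y <> 0. At the remaining points x = y = 0, p(z) = 0, the
   relation y dx + x dy = p'(z) dz gives its extension dx /\ dy / p'(z). *)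
Definition vol (q u v : 'rV[C R]_3) : C R :=
  if xc q != 0 then (xc u * zc v - zc u * xc v) / xc q
  else if yc q != 0 then - ((yc u * zc v - zc u * yc v) / yc q)
  else (xc u * yc v - yc u * xc v) / p^`().[zc q].

(* (L_T vol)(U, V) = T(vol(U, V)) - vol([T, U], V) - vol(U, [T, V]). *)
Definition Lie_derivative_vol (T U V : Dsurf -> 'rV[C R]_3) (q : Dsurf) : C R :=
  tderive (fun r => vol (set_val r) (U r) (V r)) q (T q)
  - vol (set_val q) (Lie_bracket T U q) (V q)
  - vol (set_val q) (U q) (Lie_bracket T V q).

(* U and V range over germs of holomorphic vector fields at q, so that the
   condition says that the 2-form L_T vol vanishes at q. *)
Definition volume_preserving : set (Dsurf -> 'rV[C R]_3) :=
  [set T | holo_vfield T /\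
     forall q U V, holo_vfield_at U q -> holo_vfield_at V q ->
       Lie_derivative_vol T U V q = 0].

Definition entire (g : C R -> C R) : Prop := forall t, differentiable g t.

Definition shear_x (g : C R -> C R) (q : Dsurf) : 'rV[C R]_3 :=
  let v := set_val q in
  g (xc v) *: vec3 0 p^`().[zc v] (xc v).

Definition shear_y (g : C R -> C R) (q : Dsurf) : 'rV[C R]_3 :=
  let v := set_val q in
  g (yc v) *: vec3 p^`().[zc v] 0 (yc v).

Definition shear_fields : set (Dsurf -> 'rV[C R]_3) :=
  [set V | exists2 g, entire g & V = shear_x g \/ V = shear_y g].

End Danielewski.

Arguments volume_preserving {R} p.
Arguments shear_fields {R} p.

(* Main.v *)
Require Import Defs.
From HB Require Import structures.
From mathcomp Require Import all_boot all_order all_algebra complex.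
From mathcomp Require Import all_classical all_reals all_analysis.
From mathcomp Require Import ring lra.

Set Implicit Arguments.
Unset Strict Implicit.
Unset Printing Implicit Defensive.

Import Order.TTheory GRing.Theory Num.Theory.
Import numFieldNormedType.Exports.

Local Open Scope classical_set_scope.
Local Open Scope ring_scope.

(** Contracting the volume form with a vector field turns volume preserving
    fields on D_p into functions modulo constants, and commutators into Poisson
    brackets; the shear fields become the functions of x alone and of y alone.
    The circle acts on D_p by (x, y, z) |-> (s x, y / s, z), and the mean of a
    function f over this action is a function f_0 of z. If L denotes the
    derivative along the action, then the mean of a bracket {f, g} is the
    z-derivative of the mean of (L f) g (lemma chart_poisson). Over a root a of
    p the latter mean is zero: it may be computed on the curve y = 0, z = a,
    where L = x d/dx. Functions of x or of y alone have constant mean. Hence the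
    mean of every Hamiltonian f of the generated Lie algebra has the form
    H' + c, with c constant and H zero at all roots of p (mean_exact).

    The field x d/dx - y d/dy (rot_field) is volume preserving and its
    Hamiltonian is - z. It would need H'' = - 1 for some H that vanishes at the
    roots of p, and p has at least three of them: impossible, and impossible
    even approximately (mean_gap). As H'' is a mean of values of the vector
    field over a compact set, the obstruction passes to limits for the
    compact-open topology (mean_exact_far).

    The Hamiltonians involved are not polynomials, and their brackets require
    derivatives of all orders of entire functions. Every entire function has a
    primitive which is a locally uniform limit of polynomials (entire_approx):
    Goursat's lemma is proved for trapezoid sums instead of integrals, and
    Cauchy's formula for means over roots of unity. Cauchy's estimates for
    polynomials then show that locally uniform limits of polynomials on C^3 may
    be differentiated termwise (lu_cauchy_limit). Since the derivative of a
    function on D_p in a tangent direction does not depend on the extension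
    chosen to compute it (tderive_ext), the generated Lie algebra consists of
    limits of Hamiltonian fields of polynomials to which the invariant above
    applies (Lie_generated_lim_ham). *)

(** * The modulus, limits and compactness in C *)

Section Modulus.
Variable R : realType.
Implicit Types (z w : C R) (x y : R).

(** The order of C is partial. Estimates are made on this real number, in an
    ordered field where linear arithmetic is available. *)
Definition cmod z : R := complex.Re `|z|.

Definition rc (x : R) : C R := (x%:C)%C.

Lemma cmodE z : `|z| = rc (cmod z).
Proof. by rewrite /cmod /rc normc_def. Qed.

Lemma rc_le x y : (rc x <= rc y) = (x <= y).
Proof. exact: lecR. Qed.

Lemma rc_lt x y : (rc x < rc y) = (x < y).
Proof. exact: ltcR. Qed.

Lemma rc_gt0 x : (0 < rc x) = (0 < x).
Proof. exact: rc_lt. Qed.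

Lemma rcD x y : rc (x + y) = rc x + rc y.
Proof. exact: (rmorphD (real_complex R)). Qed.

Lemma rcM x y : rc (x * y) = rc x * rc y.
Proof. exact: (rmorphM (real_complex R)). Qed.

Lemma rc_inj : injective rc.
Proof. exact: complexI. Qed.

Lemma pos_rc (e : C R) : 0 < e -> exists2 x, 0 < x & e = rc x.
Proof.
move=> e0; exists (complex.Re e).
  by move: e0; rewrite ltcE => /andP[].
by rewrite /rc (@RRe_real _ (e : R[i])) //; apply: gtr0_real.
Qed.

Lemma cmod_ge0 z : 0 <= cmod z.
Proof. by rewrite -rc_le -cmodE normr_ge0. Qed.

Lemma cmod0 : cmod 0 = 0.
Proof. by apply: rc_inj; rewrite -cmodE normr0. Qed.

Lemma cmod1 : cmod 1 = 1.
Proof. by apply: rc_inj; rewrite -cmodE normr1. Qed.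

Lemma cmod_gt0 z : z != 0 -> 0 < cmod z.
Proof. by move=> h; rewrite -rc_lt -cmodE normr_gt0. Qed.

Lemma cmodD z w : cmod (z + w) <= cmod z + cmod w.
Proof. by rewrite -rc_le rcD -!cmodE ler_normD. Qed.

Lemma cmodN z : cmod (- z) = cmod z.
Proof. by rewrite /cmod normrN. Qed.

Lemma cmodB z w : cmod (z - w) <= cmod z + cmod w.
Proof. by rewrite -(cmodN w) cmodD. Qed.

Lemma cmodC z w : cmod (z - w) = cmod (w - z).
Proof. by rewrite -cmodN opprB. Qed.

Lemma cmodM z w : cmod (z * w) = cmod z * cmod w.
Proof. by apply: rc_inj; rewrite rcM -!cmodE normrM. Qed.

Lemma cmodX z n : cmod (z ^+ n) = cmod z ^+ n.
Proof. by elim: n => [|n IH]; rewrite ?expr0 ?cmod1 // !exprS cmodM IH. Qed.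

Lemma cmodV z : cmod z^-1 = (cmod z)^-1.
Proof.
have [->|z0] := eqVneq z 0; first by rewrite invr0 cmod0 invr0.
have := cmodM z z^-1; rewrite divff // cmod1 => h.
have : cmod z != 0 by rewrite gt_eqF // cmod_gt0.
by move=> z0'; apply: (mulfI z0'); rewrite -h divff.
Qed.

Lemma cmod_rc x : cmod (rc x) = `|x|.
Proof. by apply: rc_inj; rewrite -cmodE /rc normc_def /= expr0n addr0 sqrtr_sqr. Qed.

Lemma cmod_nat n : cmod n%:R = n%:R.
Proof. by rewrite -(rmorph_nat (real_complex R)) (cmod_rc n%:R) ger0_norm. Qed.

Lemma cmod_sum (I : Type) (s : seq I) (P : pred I) (F : I -> C R) :
  cmod (\sum_(i <- s | P i) F i) <= \sum_(i <- s | P i) cmod (F i).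
Proof.
elim/big_rec2: _ => [|i y z _ h]; first by rewrite cmod0.
by apply: (le_trans (cmodD _ _)); rewrite lerD2l.
Qed.

Lemma cmod_dist z w v : cmod (z - w) <= cmod (z - v) + cmod (v - w).
Proof. by rewrite -{1}(subrK v z) -addrA cmodD. Qed.

Lemma cmod_near (c : C R) (A : set (C R)) :
  nbhs c A <-> exists2 d : R, 0 < d & forall t, cmod (t - c) < d -> A t.
Proof.
split=> [/nbhs_ballP[e /= /pos_rc[d d0 ->]] h|[d d0 h]].
  by exists d => // t ht; apply: h; rewrite -ball_normE /ball_ /= distrC cmodE rc_lt.
apply/nbhs_ballP; exists (rc d) => /=; first by rewrite rc_gt0.
by move=> t; rewrite -ball_normE /ball_ /= distrC cmodE rc_lt; exact: h.
Qed.

Lemma cvg_neq0 (T : Type) (F : set_system T) (f : T -> C R) (l : C R) : Filter F ->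
  f @ F --> l -> l != 0 -> \forall t \near F, f t != 0.
Proof.
move=> FF fl l0; apply: (fl [set x | x != 0]); exists `|l|; first by rewrite /= normr_gt0.
by move=> y /= hy; apply/eqP => y0; move: hy; rewrite y0 subr0 ltxx.
Qed.

Lemma cmod_cvg (u : nat -> C R) l :
  u @ \oo --> l <-> forall e : R, 0 < e -> exists N, forall n, (N <= n)%N -> cmod (u n - l) < e.
Proof.
split=> [/cvgrPdist_lt h e e0|h].
  have /h [N _ hN] : 0 < rc e by rewrite rc_gt0.
  by exists N => n /hN /=; rewrite distrC cmodE rc_lt.
apply/cvgrPdist_lt => e /pos_rc[d d0 ->].
by have [N hN] := h _ d0; exists N => // n /= /hN; rewrite distrC cmodE rc_lt.
Qed.

Lemma cmod_Re z : `|complex.Re z| <= cmod z.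
Proof. by rewrite -rc_le -cmodE; exact: normc_ge_Re. Qed.

Lemma cmod_Im z : `|complex.Im z| <= cmod z.
Proof.
have -> : complex.Im z = - complex.Re (z * 'i%C) by rewrite (ReiNIm z) opprK.
rewrite normrN (le_trans (cmod_Re _)) // cmodM.
suff -> : cmod 'i%C = 1 by rewrite mulr1.
by apply: rc_inj; rewrite -cmodE normc_def /= expr0n expr1n add0r sqrtr1.
Qed.

Lemma cmod_ReIm z : cmod z <= `|complex.Re z| + `|complex.Im z|.
Proof.
rewrite {1}(complexE z) (le_trans (cmodD _ _)) // cmodM.
have -> : cmod 'i%C = 1 :> R.
  by apply: rc_inj; rewrite -cmodE normc_def /= expr0n expr1n add0r sqrtr1.
by rewrite mul1r (cmod_rc (complex.Re z)) (cmod_rc (complex.Im z)).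
Qed.

Lemma real_cauchy (u : nat -> R) :
  (forall e : R, 0 < e -> exists N, forall n m, (N <= n)%N -> (N <= m)%N -> `|u n - u m| < e) ->
  exists l, forall e : R, 0 < e -> exists N, forall n, (N <= n)%N -> `|u n - l| < e.
Proof.
move=> h; have : cvg (u @ \oo).
  apply/cauchy_cvgP/cauchy_ballP => e e0.
  have [N hN] := h _ e0.
  exists (u @` [set n | (N <= n)%N], u @` [set n | (N <= n)%N]).
    by split; exists N => // n /= hn; exists n.
  by move=> [x y] [/= [n hn <-] [m hm <-]]; exact: hN.
move=> /cvgrPdist_lt hc; exists (lim (u @ \oo)) => e /hc[N _ hN].
by exists N => n /hN /=; rewrite distrC.
Qed.

Lemma cmod_cauchy (u : nat -> C R) :
  (forall e : R, 0 < e -> exists N, forall n m, (N <= n)%N -> (N <= m)%N -> cmod (u n - u m) < e) ->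
  exists l : C R, u @ \oo --> l.
Proof.
move=> h.
have [|a ha] := @real_cauchy (fun n => complex.Re (u n)).
  move=> e /h[N hN]; exists N => n m hn hm; apply: le_lt_trans (hN n m hn hm).
  apply: le_trans (cmod_Re _); rewrite le_eqVlt; apply/orP; left; apply/eqP.
  by case: (u n) (u m) => [? ?] [? ?].
have [|b hb] := @real_cauchy (fun n => complex.Im (u n)).
  move=> e /h[N hN]; exists N => n m hn hm; apply: le_lt_trans (hN n m hn hm).
  apply: le_trans (cmod_Im _); rewrite le_eqVlt; apply/orP; left; apply/eqP.
  by case: (u n) (u m) => [? ?] [? ?].
exists (a +i* b)%C; apply/cmod_cvg => e e0.
have e20 : 0 < e / 2 by rewrite divr_gt0.
have [[N hN] [M hM]] := (ha _ e20, hb _ e20).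
exists (maxn N M) => n; rewrite geq_max => /andP[/hN h1 /hM h2].
apply: (le_lt_trans (cmod_ReIm _)); rewrite [e]splitr.
by case: (u n) h1 h2 => x y /= h1 h2; rewrite ltrD.
Qed.

(** The map (a, b) |-> a + i b sends a square of R^2 onto a compact set that
    contains the closed disc. *)
Lemma disc_compact (r : R) : compact [set z : C R | cmod z <= r].
Proof.
have cf : continuous (fun v : R * R => (v.1 +i* v.2)%C : C R).
  move=> [a b]; apply/cvgrPdist_lt => e /pos_rc[d d0 ->].
  have d20 : 0 < d / 2 by rewrite divr_gt0.
  exists (ball a (d/2), ball b (d/2)) => /=.
    by split; apply: nbhsx_ballx.
  move=> [x y] [/= hx hy]; rewrite cmodE rc_lt; apply: (le_lt_trans (cmod_ReIm _)).
  by rewrite /= [ltRHS]splitr ltrD.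
have := @continuous_compact _ _ (fun v : R * R => (v.1 +i* v.2)%C : C R)
  (`[-r, r]%classic `*` `[-r, r]%classic).
move=> /(_ (continuous_subspaceT cf)
  (compact_setX (@segment_compact _ _ _) (@segment_compact _ _ _))) hc.
apply: (subclosed_compact _ hc).
  move=> z hz /=; rewrite leNgt; apply/negP => hr.
  have [|w [/= h1 h2]] := hz [set t | cmod (t - z) < cmod z - r].
    by apply/cmod_near; exists (cmod z - r); rewrite ?subr_gt0.
  by have := cmodD (z - w) w; rewrite subrK cmodC; lra.
move=> z /= hz; exists (complex.Re z, complex.Im z); last by case: z {hz}.
split=> /=; rewrite in_itv /= -ler_norml; apply: le_trans hz.
  exact: cmod_Re.
exact: cmod_Im.
Qed.

(** Only s is confined to the disc, so that points slightly outside may be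
    compared with it. *)
Lemma unif_continuous_disc (g : C R -> C R) (r : R) : continuous g ->
  forall e : R, 0 < e -> exists2 d : R, 0 < d &
    forall s t, cmod s <= r -> cmod (t - s) < d -> cmod (g t - g s) < e.
Proof.
move=> gc e e0.
have /compact_near_coveringP/(_ R (0^'+) (fun d s => forall t, cmod (t - s) < d ->
  cmod (g t - g s) < e)) :=
  @disc_compact r.
have e20 : 0 < e / 2 by rewrite divr_gt0.
case=> [s hs|].
  have /cvgrPdist_lt/(_ (rc (e/2))) := gc s.
  rewrite rc_gt0 => /(_ e20) /cmod_near[d d0 hd].
  have d20 : 0 < d / 2 by rewrite divr_gt0.
  exists ([set x | cmod (x - s) < d/2], [set x | x < d / 2]) => /=.
    split; first by apply/cmod_near; exists (d/2).
    exact: nbhs_right_lt.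
  move=> [x y] /= [hx hy] t ht.
  have h1 : cmod (x - s) < d by lra.
  have h2 : cmod (t - s) < d by have := cmod_dist t s x; lra.
  have := hd _ h1; have := hd _ h2; rewrite !cmodE !rc_lt => k1 k2.
  have := cmod_dist (g t) (g x) (g s); rewrite (cmodC (g t) (g s)); lra.
move=> d /= d0 hd; exists (d/2); first by rewrite divr_gt0.
move=> s t hs ht; apply: (hd (d/2) _ _ s hs t ht) => /=.
  rewrite sub0r normrN ger0_norm; last lra.
  lra.
by rewrite divr_gt0.
Qed.

Lemma differentiable_cmod (g : C R -> C R) c : differentiable g c ->
  exists L, forall e : R, 0 < e -> exists2 d : R, 0 < d &
    forall t, cmod (t - c) < d -> cmod (g t - g c - L * (t - c)) <= e * cmod (t - c).
Proof.
move=> gd; exists ('d g c 1) => e e0.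
have := diff_locally gd => /eqaddoP /(_ (rc e)).
rewrite rc_gt0 => /(_ e0) /cmod_near[d d0 hd].
exists d => // t ht.
have := hd (t - c); rewrite subr0 => /(_ ht) /=.
rewrite -[X in `|X| <= _]/(g (t - c + c) - (g c + 'd g c (t - c))) subrK.
have -> : 'd g c (t - c) = 'd g c 1 * (t - c).
  by rewrite -{1}[t - c]mulr1 [_ * 1]/(_ *: _) linearZ /= mulrC.
by rewrite !cmodE -rcM rc_le opprD addrA.
Qed.

End Modulus.

(** * Goursat's lemma and primitives of entire functions *)

Section Goursat.
Variable R : realType.
Implicit Types (u : C R -> C R) (a b c t : C R) (d e : R) (M : nat).

Lemma two_neq0 : (2 : C R) != 0.
Proof. by rewrite pnatr_eq0. Qed.

Lemma cmod_half a : cmod (a / 2) = cmod a / 2.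
Proof. by rewrite cmodM cmodV cmod_nat. Qed.

(** Trapezoid sums for the integral of u from a to b, on 2^M equal pieces. They
    are exact on affine functions and additive under bisection, which is what
    Goursat's argument requires of an integral. *)
Fixpoint trap u M a b : C R :=
  if M is M'.+1 then trap u M' a ((a + b) / 2) + trap u M' ((a + b) / 2) b
  else (b - a) * (u a + u b) / 2.

Lemma trapN u M a b : trap u M b a = - trap u M a b.
Proof.
elim: M a b => [|M IH] a b /=; last by rewrite [b + a]addrC (IH a ((a + b) / 2)) (IH ((a + b) /
  2) b) opprD addrC.
by rewrite -[a - b]opprB !mulNr [u b + _]addrC.
Qed.

Lemma trapB u v M a b :
  trap (fun t => u t - v t) M a b = trap u M a b - trap v M a b.
Proof.
elim: M a b => [|M IH] a b /=; first by field.
by rewrite !IH; ring.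
Qed.

Lemma trap_affine (p q : C R) M a b :
  trap (fun t => p + q * t) M a b = (b - a) * (p + q * ((a + b) / 2)).
Proof.
elim: M a b => [|M IH] a b /=; first by field.
by rewrite !IH; field.
Qed.

(** A is any midpoint-convex set containing the end points: below, a disc or the
    intersection of two discs. *)
Lemma trap_bound (A : C R -> Prop) u M a b e :
  (forall s t, A s -> A t -> A ((s + t) / 2)) -> (forall t, A t -> cmod (u t) <= e) ->
  A a -> A b -> cmod (trap u M a b) <= cmod (b - a) * e.
Proof.
move=> cA hu; elim: M a b => [|M IH] a b ha hb /=.
  rewrite cmod_half cmodM -mulrA ler_wpM2l ?cmod_ge0 // ler_pdivrMr // mulr_natr mulr2n.
  by rewrite (le_trans (cmodD _ _)) // lerD // hu.
have hm := cA _ _ ha hb.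
rewrite (le_trans (cmodD _ _)) // (le_trans (lerD (IH _ _ ha hm) (IH _ _ hm hb))) //.
have -> : (a + b) / 2 - a = (b - a) / 2 by field.
have -> : b - (a + b) / 2 = (b - a) / 2 by field.
by rewrite cmod_half; lra.
Qed.

Lemma disc_mid c d s t : cmod (s - c) <= d -> cmod (t - c) <= d -> cmod ((s + t) / 2 - c) <= d.
Proof.
move=> hs ht; have -> : (s + t) / 2 - c = ((s - c) + (t - c)) / 2 by field.
by rewrite cmod_half; have := cmodD (s - c) (t - c); lra.
Qed.

Definition tri u M a b c := trap u M a b + trap u M b c + trap u M c a.

(** The four triangles cut out by the midpoints of the sides: the sums over the
    inner edges cancel in pairs. *)
Lemma triS u M a b c : tri u M.+1 a b c =
  tri u M a ((a + b) / 2) ((c + a) / 2) + tri u M ((a + b) / 2) b ((b + c) / 2) +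
  tri u M ((c + a) / 2) ((b + c) / 2) c
  + tri u M ((a + b) / 2) ((b + c) / 2) ((c + a) / 2).
Proof.
rewrite /tri /= (trapN _ _ ((a + b) / 2) ((c + a) / 2)).
by rewrite (trapN _ _ ((b + c) / 2) ((a + b) / 2)) (trapN _ _ ((c + a) / 2) ((b + c) / 2)); ring.
Qed.

Lemma tri_affine (p q : C R) M a b c : tri (fun t => p + q * t) M a b c = 0.
Proof. by rewrite /tri !trap_affine; field. Qed.

Lemma triB u v M a b c :
  tri (fun t => u t - v t) M a b c = tri u M a b c - tri v M a b c.
Proof. by rewrite /tri !trapB; ring. Qed.

Definition small_tri u e (T : C R * C R * C R) d := exists M0, forall M, (M0 <= M)%N ->
  cmod (tri u M T.1.1 T.1.2 T.2) <= e * d ^+ 2.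

Definition sides (T : C R * C R * C R) d :=
  [/\ cmod (T.1.2 - T.1.1) <= d, cmod (T.2 - T.1.2) <= d & cmod (T.1.1 - T.2) <= d].

(** If the sums were small on the four parts of triS, they would be small on T
    by triS, since there are four of them and the square of the size is divided
    by 4. *)
Lemma bisect_bad u e T d : sides T d -> ~ small_tri u e T d ->
  exists T', [/\ sides T' (d / 2), ~ small_tri u e T' (d / 2) & cmod (T'.1.1 - T.1.1) <= d].
Proof.
case: T => [[a b] c] [/= hab hbc hca] bad.
have nz := two_neq0.
have d0 : 0 <= d by exact: le_trans (cmod_ge0 _) hab.
have e1 : (a + b) / 2 - a = (b - a) / 2 by field.
have e2 : b - (a + b) / 2 = (b - a) / 2 by field.
have e3 : (b + c) / 2 - b = (c - b) / 2 by field.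
have e4 : c - (b + c) / 2 = (c - b) / 2 by field.
have e5 : (c + a) / 2 - c = (a - c) / 2 by field.
have e6 : a - (c + a) / 2 = (a - c) / 2 by field.
have e7 : (b + c) / 2 - (a + b) / 2 = - ((a - c) / 2) by field.
have e8 : (c + a) / 2 - (b + c) / 2 = - ((b - a) / 2) by field.
have e9 : (a + b) / 2 - (c + a) / 2 = - ((c - b) / 2) by field.
have H4 : ~ (small_tri u e (a, (a + b)/2, (c + a)/2) (d/2) /\
   small_tri u e ((a + b)/2, b, (b + c)/2) (d/2) /\
   small_tri u e ((c + a)/2, (b + c)/2, c) (d/2) /\
   small_tri u e ((a + b)/2, (b + c)/2, (c + a)/2) (d/2)).
  move=> [[M1 h1] [[M2 h2] [[M3 h3] [M4 h4]]]]; apply: bad.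
  exists (maxn (maxn M1 M2) (maxn M3 M4)).+1 => -[//|M].
  rewrite ltnS !geq_max => /andP[/andP[/h1 k1 /h2 k2] /andP[/h3 k3 /h4 k4]] /=.
  rewrite triS; move: k1 k2 k3 k4 => /=.
  set t1 := tri _ _ _ _ _; set t2 := tri _ _ _ _ _.
  set t3 := tri _ _ _ _ _; set t4 := tri _ _ _ _ _ => k1 k2 k3 k4.
  have := cmodD (t1 + t2 + t3) t4; have := cmodD (t1 + t2) t3; have := cmodD t1 t2.
  have : e * (d / 2) ^+ 2 = e * d ^+ 2 / 4 by field.
  lra.
apply: contrapT => hn; apply: H4.
split; last split; last split; apply: contrapT => hb; apply: hn.
- exists (a, (a + b)/2, (c + a)/2); split => //=; last by rewrite subrr cmod0.
  by split; rewrite /= ?e1 ?e6 1?cmodC ?e9 ?cmodN cmod_half; lra.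
- exists ((a + b)/2, b, (b + c)/2); split => //=; last by rewrite e1 cmod_half; lra.
  by split; rewrite /= ?e2 ?e3 1?[cmod (_ / 2 - _ / 2)]cmodC ?e7 ?cmodN cmod_half; lra.
- exists ((c + a)/2, (b + c)/2, c); split => //=.
    by split; rewrite /= ?e5 ?e4 1?[cmod (_ / 2 - _ / 2)]cmodC ?e8 ?cmodN cmod_half; lra.
  by rewrite cmodC e6 cmod_half; lra.
- exists ((a + b)/2, (b + c)/2, (c + a)/2); split => //=; last by rewrite e1 cmod_half; lra.
  by split; rewrite /= ?e7 ?e8 ?e9 cmodN cmod_half; lra.
Qed.

(** Affine functions have zero sum around a triangle, so only the remainder of
    the affine approximation at x contributes. *)
Lemma tri_local u (p q : C R) M (T : C R * C R * C R) x d e : sides T d -> 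
  cmod (T.1.1 - x) <= 2 * d -> 0 <= e ->
  (forall t, cmod (t - x) <= 3 * d -> cmod (u t - (p + q * t)) <= e * d) ->
  cmod (tri u M T.1.1 T.1.2 T.2) <= 3 * e * d ^+ 2.
Proof.
case: T => [[a b] c] [/= hab hbc hca] ha e0 hu.
have := triB u (fun t => p + q * t) M a b c; rewrite tri_affine subr0 => <-.
rewrite /tri.
have d0 : 0 <= d by exact: le_trans (cmod_ge0 _) hab.
have ha' : cmod (a - x) <= 3 * d by lra.
have hb' : cmod (b - x) <= 3 * d by have := cmod_dist b x a; lra.
have hc' : cmod (c - x) <= 3 * d by have := cmod_dist c x a; rewrite (cmodC c a); lra.
have k1 := trap_bound M (@disc_mid x (3 * d)) hu ha' hb'.
have k2 := trap_bound M (@disc_mid x (3 * d)) hu hb' hc'.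
have k3 := trap_bound M (@disc_mid x (3 * d)) hu hc' ha'.
set t1 := trap _ _ _ _ in k1 *; set t2 := trap _ _ _ _ in k2 *.
set t3 := trap _ _ _ _ in k3 *.
have := cmodD (t1 + t2) t3; have := cmodD t1 t2.
have ed : 0 <= e * d by exact: mulr_ge0.
have := ler_wpM2r ed hab; have := ler_wpM2r ed hbc; have := ler_wpM2r ed hca.
have -> : 3 * e * d ^+ 2 = 3 * (d * (e * d)) by ring.
lra.
Qed.

(** Otherwise the estimate fails on a nested sequence of triangles, which
    shrinks to a point x; tri_local at x contradicts this. *)
Lemma goursat u : (forall t, differentiable u t) -> forall e d T, 0 < e -> sides T d ->
  small_tri u e T d.
Proof.
move=> hu e d T0 e0 hT0; apply: contrapT => bad0.
pose bad n T := sides T (d / 2 ^+ n) /\ ~ small_tri u e T (d / 2 ^+ n).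
have /choice[f hf] : forall nT : nat * (C R * C R * C R), exists T', bad nT.1 nT.2 ->
    bad nT.1.+1 T' /\ cmod (T'.1.1 - nT.2.1.1) <= d / 2 ^+ nT.1.
  move=> [n T]; have [hb|nb] := pselect (bad n T); last by exists T.
  have [T' [h1 h2 h3]] := bisect_bad hb.1 hb.2.
  by exists T' => _ /=; rewrite /bad exprSr invfM mulrA.
pose s := nat_rect (fun=> (C R * C R * C R)%type) T0 (fun n T => f (n, T)).
have hs n : bad n (s n).
  elim: n => [|n IH]; first by rewrite /bad expr0 divr1.
  exact: (hf (n, s n) IH).1.
have hs1 n : cmod ((s n.+1).1.1 - (s n).1.1) <= d / 2 ^+ n := (hf (n, s n) (hs n)).2.
have d0 : 0 <= d by case: hT0 => h _ _; exact: le_trans (cmod_ge0 _) h.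
have dn n : 0 <= d / 2 ^+ n by rewrite divr_ge0 // exprn_ge0.
have hsk n k : cmod ((s (n + k)%N).1.1 - (s n).1.1) <= 2 * (d / 2 ^+ n) - 2 * (d / 2 ^+ (n + k)).
  elim: k => [|k IH]; first by rewrite addn0 !subrr cmod0.
  rewrite addnS; have := hs1 (n + k)%N; have := cmod_dist (s (n + k).+1).1.1 (s n).1.1 (s
    (n+k)%N).1.1.
  rewrite [2 ^+ (n + k).+1]exprSr invfM [d * (_ * _)]mulrA.
  lra.
have small (x : R) : 0 < x -> exists N, forall n, (N <= n)%N -> d / 2 ^+ n < x.
  move=> x0; have := @cvg_geometric R d 2^-1 _.
  rewrite ger0_norm ?invr_ge0 // invf_lt1 // ltr1n => /(_ isT) /cvgrPdist_lt /(_ _ x0)[N _ hN].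
  by exists N => n /hN /=; rewrite sub0r normrN exprVn ger0_norm.
have [x hx] : exists x : C R, (fun n => (s n).1.1) @ \oo --> x.
  apply: cmod_cauchy => y y0; have [|N hN] := small (y / 4); first by rewrite divr_gt0.
  exists N => n m hn hm.
  have := hsk N (n - N)%N; have := hsk N (m - N)%N; rewrite !subnKC // => h1 h2.
  have := cmod_dist (s n).1.1 (s m).1.1 (s N).1.1; rewrite (cmodC (s N).1.1).
  have := hN N (leqnn _); have := dn n; have := dn m; lra.
have hsx n : cmod ((s n).1.1 - x) <= 2 * (d / 2 ^+ n).
  rewrite leNgt; apply/negP => hlt.
  have /cmod_cvg/(_ (cmod ((s n).1.1 - x) - 2 * (d / 2 ^+ n))) := hx.
  rewrite subr_gt0 => /(_ hlt)[N hN].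
  have := hN (n + N)%N (leq_addl _ _); have := hsk n N; have := dn (n + N)%N.
  have := cmod_dist (s n).1.1 x (s (n + N)%N).1.1; rewrite (cmodC (s n).1.1 (s (n + N)%N).1.1).
  lra.
have e9 : 0 < e / 9 by rewrite divr_gt0.
have [L /(_ _ e9)[r r0 hr]] := differentiable_cmod (hu x).
have [|N hN] := small (r / 4); first by rewrite divr_gt0.
have {}hN := hN N (leqnn _).
have [hT bT] := hs N; apply: bT; exists 0%N => M _.
have -> : e = 3 * (e / 3) by field.
apply: (tri_local (p := u x - L * x) (q := L)) hT (hsx N) _ _; first by rewrite divr_ge0 // ltW.
move=> t ht; have htr : cmod (t - x) < r by have := dn N; lra.
have -> : u t - (u x - L * x + L * t) = u t - u x - L * (t - x) by ring.
apply: (le_trans (hr t htr)).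
have := ler_wpM2l (ltW e9) ht; lra.
Qed.

(** On each of the 2^M pieces u is within e of its value at the left end, and
    constants are summed exactly at every level of refinement. *)
Lemma trap_refine u M k a b (r del e : R) :
  (forall s t, cmod s <= r -> cmod t <= r -> cmod (t - s) <= del -> cmod (u t - u s) <= e) ->
  cmod a <= r -> cmod b <= r -> cmod (b - a) <= del * 2 ^+ M ->
  cmod (trap u (M + k) a b - trap u M a b) <= 2 * e * cmod (b - a).
Proof.
move=> hu; elim: M a b => [|M IH] a b ha hb.
  rewrite expr0 mulr1 add0n => hab.
  have del0 := le_trans (cmod_ge0 _) hab.
  have e0 : 0 <= e by have := hu a a ha ha; rewrite !subrr cmod0; apply.
  have := trapB u (fun t => u a + 0 * t) k a b; rewrite trap_affine mul0r addr0.
  have hh : cmod (trap (fun t => u t - (u a + 0 * t)) k a b) <= cmod (b - a) * e.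
    apply: (@trap_bound (fun t => cmod t <= r /\ cmod (t - a) <= del)) => //.
    - move=> s t [s1 s2] [t1 t2]; split; last exact: disc_mid.
      by have := @disc_mid 0 r s t; rewrite !subr0; apply.
    - by move=> t [t1 t2]; rewrite mul0r addr0; exact: hu.
    - by rewrite subrr cmod0.
  move=> heq; rewrite heq in hh.
  have -> : trap u k a b - trap u 0 a b =
     trap u k a b - (b - a) * u a - (b - a) * ((u b - u a) / 2) by rewrite /=; field.
  have := cmodB (trap u k a b - (b - a) * u a) ((b - a) * ((u b - u a) / 2)).
  rewrite [cmod ((b - a) * _)]cmodM cmod_half.
  have := ler_wpM2l (cmod_ge0 (b - a)) (hu a b ha hb hab).
  have := mulr_ge0 (cmod_ge0 (b - a)) e0.
  lra.
rewrite exprS => hab; rewrite addSn /=.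
have hm : cmod ((a + b) / 2) <= r by have := @disc_mid 0 r a b; rewrite !subr0; apply.
have e1 : (a + b) / 2 - a = (b - a) / 2 by field.
have e2 : b - (a + b) / 2 = (b - a) / 2 by field.
have := IH a ((a + b) / 2) ha hm; have := IH ((a + b) / 2) b hm hb.
rewrite e1 e2 cmod_half => h1 h2.
have h : cmod (b - a) / 2 <= del * 2 ^+ M by lra.
have {}h1 := h1 h; have {}h2 := h2 h.
set x1 := trap _ _ a _ in h2 *; set x2 := trap u (M + k) _ b in h1 *.
set y1 := trap _ _ a _ in h2 *; set y2 := trap u M _ b in h1 *.
have -> : x1 + x2 - (y1 + y2) = (x1 - y1) + (x2 - y2) by ring.
have := cmodD (x1 - y1) (x2 - y2); lra.
Qed.

Lemma pow2_unbounded (x del : R) : 0 < del -> exists M, x <= del * 2 ^+ M.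
Proof.
move=> d0; have [n hn] : exists n : nat, x / del <= n%:R.
  exists (Num.bound `|x / del|); apply/ltW.
  by apply: (le_lt_trans (ler_norm _)); apply: archi_boundP.
exists n; rewrite mulrC -ler_pdivrMr // (le_trans hn) // -natrX ler_nat.
exact/ltnW/ltn_expl.
Qed.

(** U t is the limit of the sums from 0 to t, and by Goursat's lemma U s - U t
    is the limit of the sums from t to s, on which u is almost constant. The
    conclusion is differentiability uniform on discs, the form used for the
    discrete Cauchy formula. *)
Theorem primitive u : (forall t, differentiable u t) ->
  exists U : C R -> C R, forall r e : R, 0 < e -> exists2 del : R, 0 < del &
    forall s t, cmod s <= r -> cmod t <= r -> cmod (s - t) < del ->
      cmod (U s - U t - u t * (s - t)) <= e * cmod (s - t).
Proof.
move=> ud.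
have uc : continuous u by move=> t; exact: differentiable_continuous.
have ucU r e : 0 < e -> exists2 d : R, 0 < d & forall s t, cmod s <= r -> cmod (t - s) <= d ->
  cmod (u t - u s) <= e.
  move=> e0; have [d d0 hd] := unif_continuous_disc r uc e0.
  exists (d / 2); first by rewrite divr_gt0.
  by move=> s t hs ht; apply/ltW/hd => //; lra.
have /choice[U hU] : forall t, exists l : C R, (fun M => trap u M 0 t) @ \oo --> l.
  move=> t; apply: cmod_cauchy => e e0.
  have e1 : 0 < e / (4 * cmod t + 1).
    by rewrite divr_gt0 //; have := cmod_ge0 t; lra.
  have [d d0 hd] := ucU (cmod t) _ e1.
  have [M0 hM0] := pow2_unbounded (cmod t) d0.
  exists M0 => n m hn hm.
  have ht : cmod (t - 0) <= d * 2 ^+ M0 by rewrite subr0.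
  have h0 : cmod (0 : C R) <= cmod t by rewrite cmod0 cmod_ge0.
  have hh s s' : cmod s <= cmod t -> cmod s' <= cmod t -> cmod (s' - s) <= d ->
    cmod (u s' - u s) <= e / (4 * cmod t + 1) by move=> ? _; exact: hd.
  have := trap_refine (n - M0) hh h0 (lexx _) ht.
  have := trap_refine (m - M0) hh h0 (lexx _) ht.
  rewrite !subnKC // subr0 => h1 h2.
  have := cmod_dist (trap u n 0 t) (trap u m 0 t) (trap u M0 0 t).
  rewrite (cmodC (trap u M0 0 t)).
  have : 4 * (e / (4 * cmod t + 1)) * cmod t < e.
    have k : 0 < 4 * cmod t + 1 by have := cmod_ge0 t; lra.
    have -> : 4 * (e / (4 * cmod t + 1)) * cmod t = e * ((4 * cmod t) / (4 * cmod t + 1)).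
      by field; rewrite gt_eqF.
    by rewrite gtr_pMr // ltr_pdivrMr //; lra.
  lra.
exists U => r e e0; have [d d0 hd] := ucU r e e0.
exists d => // s t hs ht hst.
apply/ler_addgt0Pr => eta eta0.
have eta4 : 0 < eta / 4 by rewrite divr_gt0.
have /cmod_cvg/(_ _ eta4)[N1 h1] := hU s.
have /cmod_cvg/(_ _ eta4)[N2 h2] := hU t.
have [d' hside] : exists d', sides (0, t, s) d'.
  exists (cmod t + cmod s); split=> /=.
  - by rewrite subr0; have := cmod_ge0 s; lra.
  - by have := cmodB s t; lra.
  - by rewrite sub0r cmodN; have := cmod_ge0 t; lra.
have e4 : 0 < eta / (4 * (d' ^+ 2 + 1)).
  by rewrite divr_gt0 //; have := sqr_ge0 d'; lra.
have [N3 h3] := goursat ud e4 hside.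
pose M := (N1 + N2 + N3)%N.
have {}h1 := h1 M (leq_trans (leq_addr _ _) (leq_addr _ _)).
have {}h2 := h2 M (leq_trans (leq_addl _ _) (leq_addr _ _)).
have {}h3 := h3 M (leq_addl _ _); rewrite /= in h3.
have {}h3 : cmod (tri u M 0 t s) <= eta / 4.
  apply: (le_trans h3).
  have k : 0 < d' ^+ 2 + 1 by have := sqr_ge0 d'; lra.
  have -> : eta / (4 * (d' ^+ 2 + 1)) * d' ^+ 2 = eta / 4 * (d' ^+ 2 / (d' ^+ 2 + 1)).
    by field; rewrite gt_eqF.
  by rewrite ger_pMr // ler_pdivrMr //; lra.
have h4 : cmod (trap u M t s - u t * (s - t)) <= e * cmod (s - t).
  have := trapB u (fun x => u t + 0 * x) M t s; rewrite trap_affine mul0r addr0 mulrC => <-.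
  rewrite [e * _]mulrC.
  apply: (@trap_bound (fun x => cmod (x - t) <= cmod (s - t))); rewrite ?subrr ?cmod0 ?cmod_ge0 //.
    exact: disc_mid.
  by move=> x hx; rewrite mul0r addr0; apply: hd => //; lra.
rewrite /tri (trapN _ _ 0 s) in h3.
have -> : U s - U t - u t * (s - t) = (trap u M t s - u t * (s - t)) - (trap u M 0 s - U s)
   + (trap u M 0 t - U t) - (trap u M 0 t + trap u M t s - trap u M 0 s) by ring.
move: h1 h2 h3 h4; set x1 := trap u M 0 s - U s; set x2 := trap u M 0 t - U t.
set x3 := trap u M 0 t + _ - _; set x4 := trap u M t s - _ => h1 h2 h3 h4.
have := cmodB (x4 - x1 + x2) x3; have := cmodD (x4 - x1) x2; have := cmodB x4 x1.
lra.
Qed.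

End Goursat.

(** * Roots of unity and polynomial interpolation *)

Section Roots.
Variable R : realType.
Implicit Types (z w : C R) (e d r : R).

Lemma cmod_unit_root z N : (0 < N)%N -> z ^+ N = 1 -> cmod z = 1.
Proof.
move=> N0 h; have : cmod z ^+ N = 1 by rewrite -cmodX h cmod1.
by move=> /eqP; rewrite pexpr_eq1 ?cmod_ge0 // => /eqP.
Qed.

Lemma sum_unit_root w N : w ^+ N = 1 -> w != 1 -> \sum_(0 <= k < N) w ^+ k = 0.
Proof.
move=> h w1; have := subrX1 w N; rewrite h subrr => /esym/eqP.
by rewrite mulf_eq0 subr_eq0 (negPf w1) /= big_mkord => /eqP.
Qed.

Lemma cmod_sqr z : cmod z ^+ 2 = complex.Re z ^+ 2 + complex.Im z ^+ 2.
Proof. by apply: rc_inj; rewrite /rc rmorphXn /= -/(rc _) -cmodE add_Re2_Im2. Qed.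

(** For the square root with nonnegative real part, |z - 1| |z + 1| = |w - 1|
    and |z + 1|^2 is at least 2. *)
Lemma cmod_sqrt_unit w : cmod w = 1 -> exists z, [/\ z ^+ 2 = w, cmod z = 1 &
  cmod (z - 1) ^+ 2 * 2 <= cmod (w - 1) ^+ 2].
Proof.
move=> hw.
have [z [hz rz]] : exists z, z ^+ 2 = w /\ 0 <= complex.Re z.
  have hs := sqrtCK w.
  have [h|h] := lerP 0 (complex.Re (sqrtC w)); first by exists (sqrtC w).
  exists (- sqrtC w); rewrite sqrrN; split => //.
  by move: h; case: (sqrtC w) => a b /= h; lra.
have z1 : cmod z = 1.
  by have := cmodX z 2; rewrite hz hw => /esym/eqP; rewrite pexpr_eq1 ?cmod_ge0 // => /eqP.
exists z; split => //.
have -> : w - 1 = (z - 1) * (z + 1) by rewrite -hz; ring.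
rewrite cmodM exprMn ler_wpM2l ?sqr_ge0 // cmod_sqr.
have := cmod_sqr z; rewrite z1.
by move: rz; case: z {hz z1} => a b /= ra; rewrite expr1n addr0 => hab; nra.
Qed.

(** Iterated square roots of -1 are primitive roots of unity whose orders are
    the powers of 2, and by cmod_sqrt_unit they can be chosen to tend to 1. *)
Lemma primitive_roots e N0 : 0 < e -> exists N z, [/\ (N0 < N)%N,
  N.-primitive_root z & cmod (z - 1) < e].
Proof.
move=> e0.
have H j : exists z, [/\ z ^+ (2 ^ j) = -1, cmod z = 1 & cmod (z - 1) ^+ 2 * 2 ^+ j <= 4].
  elim: j => [|j [z [h1 h2 h3]]].
    exists (-1); rewrite expn0 expr1 cmodN cmod1; split => //.
    by rewrite expr0 mulr1 -opprD cmodN -[X in cmod X]/(2%:R : C R) cmod_nat; lra.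
  have [z' [k1 k2 k3]] := cmod_sqrt_unit h2.
  exists z'; split => //; first by rewrite expnS exprM k1.
  rewrite [2 ^+ j.+1]exprS mulrA; apply: le_trans h3.
  by rewrite ler_wpM2r // exprn_ge0.
have [j1 hj1] : exists j, 4 < e ^+ 2 * 2 ^+ j.
  have e2 : 0 < e ^+ 2 by rewrite exprn_gt0.
  have [j hj] := pow2_unbounded 5 e2; exists j; lra.
pose j := (j1 + N0)%N; have [z [h1 h2 h3]] := H j.
exists (2 ^ j.+1)%N, z; split.
- apply: (leq_trans (ltn_expl N0 (ltnSn 1))).
  by rewrite leq_exp2l // (leq_trans (leq_addl j1 N0)).
- have hN : z ^+ (2 ^ j.+1) = 1 by rewrite expnSr exprM h1 sqrrN expr1n.
  have [//|m pm] := prim_order_exists _ hN; first by rewrite expn_gt0.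
  move=> /(@dvdn_pfactor 2 _ _ isT)[i hi mi].
  move: hi; rewrite leq_eqVlt => /orP[/eqP <-|]; first by rewrite -mi.
  rewrite ltnS => hi; have : z ^+ (2 ^ j) = 1.
    by rewrite -(subnKC hi) expnD exprM -mi (prim_expr_order pm) expr1n.
  rewrite h1 => /eqP; rewrite eq_sym -subr_eq0 opprK -[1 + 1]/(2%:R).
  by rewrite pnatr_eq0.
- rewrite ltNge; apply/negP => he.
  have e2 : e ^+ 2 <= cmod (z - 1) ^+ 2 by rewrite ler_pXn2r // nnegrE ?cmod_ge0 // ltW.
  have p2 k : 0 <= (2 : R) ^+ k by rewrite exprn_ge0.
  have p3 : (2 : R) ^+ j1 <= 2 ^+ j by rewrite ler_eXn2l ?ltr1n // leq_addr.
  have := ler_wpM2r (p2 j) e2; have := ler_wpM2l (sqr_ge0 e) p3; lra.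
Qed.

Lemma prim_sum z N m : N.-primitive_root z -> (0 < m < N)%N ->
  \sum_(0 <= k < N) (z ^+ k) ^+ m = 0.
Proof.
move=> pz /andP[m0 mN].
transitivity (\sum_(0 <= k < N) (z ^+ m) ^+ k).
  by apply: eq_bigr => k _; rewrite -!exprM mulnC.
apply: sum_unit_root; first by rewrite -exprM mulnC exprM (prim_expr_order pz) expr1n.
by rewrite -(prim_order_dvd pz) gtnNdvd.
Qed.

Lemma prim_rootV z N : N.-primitive_root z -> N.-primitive_root z^-1.
Proof.
move=> pz; have N0 := prim_order_gt0 pz.
have hN : z^-1 ^+ N = 1 by rewrite exprVn (prim_expr_order pz) invr1.
have [m pm mN] := prim_order_exists N0 hN.
suff -> : N = m by [].
apply/eqP; rewrite eqn_dvd mN andbT (prim_order_dvd pz).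
by have := prim_expr_order pm; rewrite exprVn => /eqP; rewrite invr_eq1.
Qed.

(** Orthogonality of the characters of the group of N-th roots of unity. This is
    the discrete form of Cauchy's integral for a coefficient; it is exact as
    soon as N exceeds the degree. *)
Lemma prim_fourier (V : lmodType (C R)) (N d n : nat) z (c : nat -> V) : N.-primitive_root z ->
  (d < N)%N -> (n <= N)%N ->
  \sum_(0 <= k < N) (z ^+ k) ^- d *: (\sum_(i < n) (z ^+ k) ^+ i *: c i) =
  N%:R *: (if (d < n)%N then c d else 0).
Proof.
move=> pz dN nN; have zN := prim_expr_order pz.
have N0 : (0 < N)%N by exact: leq_ltn_trans dN.
have z0 : z != 0.
  by apply/eqP => h; move: zN; rewrite h expr0n gtn_eqF // => /eqP; rewrite eq_sym oner_eq0.
transitivity (\sum_(i < n) (\sum_(0 <= k < N) (z ^+ i / z ^+ d) ^+ k) *: c i).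
  under [RHS]eq_bigr do rewrite scaler_suml.
  rewrite exchange_big /=; apply: eq_bigr => k _; rewrite scaler_sumr; apply: eq_bigr => i _.
  by rewrite scalerA expr_div_n -!exprM mulrC (mulnC k i) (mulnC k d).
have zero i : (i < N)%N -> i != d -> \sum_(0 <= k < N) (z ^+ i / z ^+ d) ^+ k = 0.
  move=> iN /eqP im; apply: sum_unit_root.
    by rewrite expr_div_n -!exprM mulnC (mulnC d) !exprM zN !expr1n divr1.
  apply/eqP => h; apply: im; apply/eqP.
  have : z ^+ i == z ^+ d by rewrite -(divfK (expf_neq0 d z0) (z ^+ i)) h mul1r.
  by rewrite (eq_prim_root_expr pz) !modn_small.
case: ifP => dn; last first.
  rewrite scaler0 big1 // => i _; rewrite zero ?scale0r //.
    exact: leq_trans (ltn_ord i) nN.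
  by apply: contraFN dn => /eqP <-.
have rest : \sum_(i < n | i != Ordinal dn) (\sum_(0 <= k < N) (z ^+ i / z ^+ d) ^+ k) *: c i = 0.
  by apply: big1 => i im; rewrite zero ?scale0r // (leq_trans (ltn_ord i) nN).
rewrite (bigD1 (Ordinal dn)) //= rest addr0 divff ?expf_neq0 //.
under eq_bigr do rewrite expr1n.
by rewrite sumr_const_nat subn0.
Qed.

(** A discrete Cauchy formula. The points t k = r z^k lie on the circle of
    radius r, and om w k is the truncated geometric expansion of the Cauchy
    kernel t k / (t k - w), divided by N; its sum over k is 1. The expression h
    w lam, the sum over k of U (w + lam (t k - w)) (om w k), goes from U w at
    lam = 0 to a polynomial in w at lam = 1. Its derivative in lam is up to a
    factor the sum of t k u (w + lam (t k - w)), a Riemann sum for the integral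
    of u along a closed polygon, which is small because the increments of U
    along that polygon add up to zero. *)
Section Approx.
Variables (u U : C R -> C R) (r e del : R) (N : nat) (z : C R).
Hypothesis r0 : 0 < r.
Hypothesis e0 : 0 <= e.
Hypothesis hU : forall s t, cmod s <= r -> cmod t <= r -> cmod (s - t) < del ->
      cmod (U s - U t - u t * (s - t)) <= e * cmod (s - t).
Hypothesis pz : N.-primitive_root z.
Hypothesis N2 : (1 < N)%N.
Hypothesis hz : r * cmod (z - 1) < del.

Let t k : C R := rc r * z ^+ k.
Let om (w : C R) k : C R := N%:R^-1 * \sum_(0 <= m < N) (w / t k) ^+ m.
Let th (w : C R) := (w / rc r) ^+ N.
Let N0 : (N%:R : C R) != 0. Proof. by rewrite pnatr_eq0 -lt0n (ltn_trans _ N2). Qed.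
Let N0R : 0 < (N%:R : R). Proof. by rewrite ltr0n (ltn_trans _ N2). Qed.
Let rc0 : rc r != 0. Proof. by rewrite -[0]/(rc 0) (inj_eq (@rc_inj R)) gt_eqF. Qed.
Let zN : z ^+ N = 1 := prim_expr_order pz.
Let z0 : z != 0.
Proof. by apply/eqP => h; move: zN; rewrite h expr0n gtn_eqF ?(ltn_trans _ N2) // => /eqP;
  rewrite eq_sym oner_eq0. Qed.
Let nmz : cmod z = 1 := cmod_unit_root (ltn_trans (ltn0Sn 0) N2) zN.
Let t0 k : t k != 0. Proof. by rewrite mulf_neq0 // expf_neq0. Qed.
Let nmt k : cmod (t k) = r.
Proof. by rewrite cmodM cmod_rc cmodX nmz expr1n mulr1 ger0_norm // ltW. Qed.

Let sum_om w : \sum_(0 <= k < N) om w k = 1.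
Proof.
rewrite /om -mulr_sumr exchange_big /=.
rewrite big_ltn; last exact: ltn_trans N2.
rewrite [X in _ + X]big_nat_cond [X in _ + X]big1 => [|m].
  under eq_bigr do rewrite expr0.
  by rewrite addr0 sumr_const_nat subn0 mulVf.
rewrite andbT => hm.
transitivity (\sum_(0 <= k < N) (w / rc r) ^+ m * (z^-1 ^+ k) ^+ m).
  by apply: eq_bigr => k _; rewrite /t -exprMn invfM exprVn mulrA.
by rewrite -mulr_sumr (prim_sum (prim_rootV pz)) // mulr0.
Qed.

(** The denominator of the Cauchy kernel is cleared up to th w, the contribution
    of the truncation. *)
Let om_eq w k : (t k - w) * om w k = t k * (1 - th w) / N%:R.
Proof.
rewrite /om mulrCA mulrC; congr (_ / _).
have -> : t k - w = t k * (1 - w / t k) by rewrite mulrBr mulr1 mulrCA divff // mulr1.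
rewrite -mulrA; congr (_ * _); apply: oppr_inj; rewrite -mulNr !opprB big_mkord -subrX1.
by rewrite /th /t invfM mulrA exprMn exprVn -exprM mulnC exprM zN expr1n invr1 mulr1.
Qed.

Let cmod_om w k : cmod w <= r -> cmod (t k - w) * cmod (om w k) <= 2 * r / N%:R.
Proof.
move=> hw; rewrite -cmodM om_eq cmodM cmodV cmod_nat cmodM nmt.
rewrite ler_pM2r ?invr_gt0 // mulrC ler_pM2r //.
have := cmodB 1 (th w); rewrite cmod1 /th cmodX cmodM cmodV cmod_rc (ger0_norm (ltW r0)) => h.
apply: (le_trans h).
suff : (cmod w / r) ^+ N <= 1 by lra.
by rewrite exprn_ile1 // ?divr_ge0 ?cmod_ge0 ?ler_pdivrMr ?mul1r // ltW.
Qed.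

Let z1 : z != 1.
Proof. by have := prim_order_dvd pz 1; rewrite expr1 dvdn1 => <-; rewrite gtn_eqF. Qed.

Let sum_t : \sum_(0 <= k < N) t k = 0.
Proof. by rewrite -mulr_sumr sum_unit_root ?mulr0. Qed.

Let xi w (lam : R) k : C R := w + rc lam * (t k - w).

Let xi_r w lam k : cmod w <= r -> 0 <= lam <= 1 -> cmod (xi w lam k) <= r.
Proof.
move=> hw /andP[l0 l1].
have -> : xi w lam k = rc (1 - lam) * w + rc lam * t k.
  have -> : rc (1 - lam) = 1 - rc lam by rewrite /rc rmorphB.
  by rewrite /xi; ring.
rewrite (le_trans (cmodD _ _)) // (cmodM (rc _)) (cmodM _ (t k)) nmt !cmod_rc !ger0_norm //;
  last lra.
have h : 0 <= 1 - lam by lra.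
by have := ler_wpM2l h hw; lra.
Qed.

(** Along the closed polygon xi w lam the increments of U cancel, and each is u
    times the side up to a relative error e. *)
Let sum_tu w lam : cmod w <= r -> 0 <= lam <= 1 ->
  cmod (\sum_(0 <= k < N) t k * u (xi w lam k)) <= e * r * N%:R.
Proof.
move=> hw hl; have [l0|ln0] := eqVneq lam 0.
  have hx k : xi w lam k = w by rewrite /xi l0 -[rc 0]/(0 : C R) mul0r addr0.
  under eq_bigr do rewrite hx.
  rewrite -mulr_suml sum_t mul0r cmod0; apply: mulr_ge0; last exact: ler0n.
  by apply: mulr_ge0 => //; exact: ltW.
have lp : 0 < lam by rewrite lt_neqAle eq_sym ln0; case/andP: hl.
have dxi k : xi w lam k.+1 - xi w lam k = rc lam * t k * (z - 1).
  by rewrite /xi /t exprS; ring.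
have ndxi k : cmod (xi w lam k.+1 - xi w lam k) = lam * r * cmod (z - 1).
  by rewrite dxi (cmodM (_ * _)) (cmodM (rc lam)) nmt cmod_rc gtr0_norm.
have hdel k : cmod (xi w lam k.+1 - xi w lam k) < del.
  rewrite ndxi; apply: le_lt_trans hz; rewrite -mulrA ler_piMl //.
    by rewrite mulr_ge0 ?cmod_ge0 // ltW.
  by case/andP: hl.
pose E k := U (xi w lam k.+1) - U (xi w lam k) - u (xi w lam k) * (xi w lam k.+1 - xi w lam k).
have hE k : cmod (E k) <= e * (lam * r * cmod (z - 1)).
  by rewrite -(ndxi k) /E; apply: hU => //; exact: xi_r.
have tele : \sum_(0 <= k < N) (U (xi w lam k.+1) - U (xi w lam k)) = 0.
  by rewrite telescope_sumr // /xi /t zN expr0 subrr.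
have hs : rc lam * (z - 1) * (\sum_(0 <= k < N) t k * u (xi w lam k)) = - \sum_(0 <= k < N) E k.
  have : \sum_(0 <= k < N) E k = \sum_(0 <= k < N) (U (xi w lam k.+1) - U (xi w lam k))
     - \sum_(0 <= k < N) u (xi w lam k) * (xi w lam k.+1 - xi w lam k) by rewrite -sumrB.
  rewrite tele sub0r => ->; rewrite opprK mulr_sumr.
  by apply: eq_bigr => k _; rewrite dxi; ring.
have hs2 : lam * cmod (z - 1) * cmod (\sum_(0 <= k < N) t k * u (xi w lam k)) <=
   lam * cmod (z - 1) * (e * r * N%:R).
  have nl : cmod (rc lam) = lam by rewrite cmod_rc gtr0_norm.
  rewrite -[X in X * cmod (z - 1) * cmod _]nl -!cmodM hs cmodN (le_trans (cmod_sum _ _ _)) //.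
  have -> : lam * cmod (z - 1) * (e * r * N%:R) = \sum_(0 <= k < N) e * (lam * r * cmod (z - 1)).
    by rewrite sumr_const_nat subn0 -mulr_natr; ring.
  by apply: ler_sum => k _; exact: hE.
by move: hs2; rewrite ler_pM2l // mulr_gt0 // cmod_gt0 // subr_eq0.
Qed.

Let h w lam := \sum_(0 <= k < N) U (xi w lam k) * om w k.

Let h_step w lam lam' : cmod w <= r -> 0 <= lam <= 1 -> 0 <= lam' <= 1 -> lam <= lam' ->
  (lam' - lam) * (2 * r) < del ->
  cmod (h w lam' - h w lam) <= (lam' - lam) * (4 * e * r).
Proof.
move=> hw hl hl' hll hd.
pose dl := lam' - lam; have dl0 : 0 <= dl by rewrite subr_ge0.
have dxi k : xi w lam' k - xi w lam k = rc dl * (t k - w).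
  by rewrite /xi /dl /rc rmorphB /=; ring.
have ntw k : cmod (t k - w) <= 2 * r by have := cmodB (t k) w; rewrite nmt; lra.
pose E k := U (xi w lam' k) - U (xi w lam k) - u (xi w lam k) * (xi w lam' k - xi w lam k).
have hE k : cmod (E k) <= e * (dl * cmod (t k - w)).
  have -> : dl * cmod (t k - w) = cmod (xi w lam' k - xi w lam k).
    by rewrite dxi cmodM cmod_rc ger0_norm.
  apply: hU; [exact: xi_r|exact: xi_r|].
  rewrite dxi cmodM cmod_rc ger0_norm //; apply: le_lt_trans hd.
  exact: ler_wpM2l.
have -> : h w lam' - h w lam = \sum_(0 <= k < N) E k * om w k +
   rc dl * ((1 - th w) / N%:R) * \sum_(0 <= k < N) t k * u (xi w lam k).
  rewrite /h -sumrB mulr_sumr -big_split /=; apply: eq_bigr => k _.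
  have -> : rc dl * ((1 - th w) / N%:R) * (t k * u (xi w lam k)) =
    rc dl * u (xi w lam k) * (t k * (1 - th w) / N%:R) by ring.
  by rewrite -om_eq /E dxi; ring.
have b1 : cmod (\sum_(0 <= k < N) E k * om w k) <= dl * (2 * e * r).
  apply: (le_trans (cmod_sum _ _ _)).
  have -> : dl * (2 * e * r) = \sum_(0 <= k < N) e * dl * (2 * r / N%:R).
    by rewrite sumr_const_nat subn0 -mulr_natr; field; rewrite gt_eqF.
  apply: ler_sum => k _; rewrite cmodM.
  apply: (le_trans (ler_wpM2r (cmod_ge0 _) (hE k))).
  have -> : e * (dl * cmod (t k - w)) * cmod (om w k) = e * dl * (cmod (t k - w) * cmod (om w
    k)) by ring.
  by rewrite ler_wpM2l ?mulr_ge0 // cmod_om.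
have nth : cmod (1 - th w) <= 2.
  have := cmod_om 0 hw; rewrite -cmodM om_eq (cmodM _ N%:R^-1) (cmodM (t 0)) cmodV cmod_nat nmt.
  by rewrite ler_pM2r ?invr_gt0 // [r * _]mulrC ler_pM2r.
have b2 : cmod (rc dl * ((1 - th w) / N%:R) * \sum_(0 <= k < N) t k * u (xi w lam k)) <=
    dl * (2 * e * r).
  rewrite !cmodM cmod_rc (ger0_norm dl0) -mulrA ler_wpM2l // cmodV cmod_nat.
  apply: (@le_trans _ _ (2 / N%:R * (e * r * N%:R))).
    apply: ler_pM; [by rewrite mulr_ge0 ?cmod_ge0 // invr_ge0 ltW|exact: cmod_ge0| |exact: sum_tu].
    by rewrite ler_pM2r ?invr_gt0.
  by rewrite le_eqVlt; apply/orP; left; apply/eqP; field; rewrite gt_eqF.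
have := cmodD (\sum_(0 <= k < N) E k * om w k) (rc dl * ((1 - th w) / N%:R) * \sum_(0 <= k < N)
  t k * u (xi w lam k)).
rewrite -/dl; lra.
Qed.

(** The polynomial interpolates U at the points t k. The parameter lam runs
    through the multiples of 2^-L, a step short enough for h_step. *)
Lemma interpolation : 0 < del -> exists P : {poly C R}, forall w, cmod w <= r ->
  cmod (P.[w] - U w) <= 4 * e * r.
Proof.
move=> del0.
pose P : {poly C R} := \sum_(0 <= k < N) \sum_(0 <= m < N) (U (t k) / N%:R / t k ^+ m) *: 'X^m.
exists P => w hw.
have -> : P.[w] = h w 1.
  rewrite /P /h horner_sum; apply: eq_bigr => k _.
  have -> : xi w 1 k = t k by rewrite /xi -[rc 1]/(1 : C R); ring.
  rewrite horner_sum /om mulrA mulr_sumr; apply: eq_bigr => m _.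
  by rewrite hornerZ hornerXn expr_div_n; ring.
have -> : U w = h w 0.
  rewrite /h -[LHS]mulr1 -(sum_om w) mulr_sumr; apply: eq_bigr => k _.
  by congr (U _ * _); rewrite /xi -[rc 0]/(0 : C R); ring.
have [L hL] := pow2_unbounded (2 * r + 1) del0.
pose n := (2 ^ L)%N.
have n0 : 0 < (n%:R : R) by rewrite ltr0n expn_gt0.
have stepd (j : nat) : (j.+1%:R / n%:R - j%:R / n%:R : R) * (2 * r) < del.
  rewrite -mulrBl -natrB // subSnn mulrAC ltr_pdivrMr // natrX mul1r; lra.
have inI j : (j <= n)%N -> 0 <= (j%:R / n%:R : R) <= 1.
  by move=> hj; rewrite divr_ge0 ?ler0n // ler_pdivrMr // mul1r ler_nat.
have : forall j, (j <= n)%N -> cmod (h w (j%:R / n%:R) - h w 0) <= (j%:R / n%:R) * (4 * e * r).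
  elim=> [_|j IH hj]; first by rewrite !mul0r subrr cmod0.
  have {}IH := IH (ltnW hj).
  have := h_step hw (inI _ (ltnW hj)) (inI _ hj) _ (stepd j).
  rewrite ler_pM2r ?invr_gt0 // ler_nat leqnSn => /(_ isT).
  have := cmod_dist (h w (j.+1%:R / n%:R)) (h w 0) (h w (j%:R / n%:R)); lra.
by move=> /(_ n (leqnn _)); rewrite divff ?mul1r // gt_eqF.
Qed.

End Approx.

Lemma poly_approx (u U : C R -> C R) :
  (forall r e : R, 0 < e -> exists2 del : R, 0 < del &
    forall s t, cmod s <= r -> cmod t <= r -> cmod (s - t) < del ->
      cmod (U s - U t - u t * (s - t)) <= e * cmod (s - t)) ->
  forall r e, 0 < e -> exists P : {poly C R}, forall w, cmod w <= r -> cmod (P.[w] - U w) <= e.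
Proof.
move=> hU r e e0.
pose r' := Num.max r 1; have r0 : 0 < r' by rewrite lt_max ltr01 orbT.
have e1 : 0 < e / (4 * r') by rewrite divr_gt0 // mulr_gt0.
have [del d0 hd] := hU r' _ e1.
have [|N [z [N1 pz hz]]] := @primitive_roots (del / r') 1; first by rewrite divr_gt0.
have hz' : r' * cmod (z - 1) < del by rewrite mulrC -ltr_pdivlMr.
have [P hP] := interpolation r0 (ltW e1) hd pz N1 hz' d0.
exists P => w hw; have -> : e = 4 * (e / (4 * r')) * r' by field; rewrite gt_eqF.
by apply: hP; rewrite le_max hw.
Qed.

End Roots.

(** * Cauchy estimates and polynomial approximation of entire functions *)

Section PolyBounds.
Variable R : realType.
Implicit Types (P : {poly C R}) (t h : C R) (s e r M : R).

(** Cauchy's estimate: the mean of t^-m P over the N-th roots of unity on the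
    circle of radius s is the coefficient of index m. *)
Lemma coef_bound P s M m : 0 <= s -> (forall t, cmod t <= s -> cmod P.[t] <= M) ->
  cmod P`_m * s ^+ m <= M.
Proof.
move=> s0 hP; have [N [z [hN pz _]]] := @primitive_roots R 1 (size P + m) ltr01.
have N0 : (0 < N)%N by exact: leq_ltn_trans hN.
have mN : (m < N)%N by apply: leq_ltn_trans hN; exact: leq_addl.
have zN := prim_expr_order pz.
have nz := cmod_unit_root N0 zN.
have nk k : cmod (z ^+ k) = 1 by rewrite cmodX nz expr1n.
have e1 : \sum_(0 <= k < N) P.[rc s * z ^+ k] / (z ^+ k) ^+ m = N%:R * (P`_m * rc s ^+ m).
  have sN : (size P <= N)%N by rewrite ltnW // (leq_ltn_trans _ hN) // leq_addr.
  have := @prim_fourier _ (C R)^o N m (size P) z (fun i => P`_i * rc s ^+ i) pz mN sN.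
  have -> : (if (m < size P)%N then P`_m * rc s ^+ m else 0) = P`_m * rc s ^+ m.
    by case: ltnP => // h; rewrite nth_default ?mul0r.
  move=> h; apply: (etrans _ h); apply: eq_bigr => k _; rewrite mulrC; congr (_ * _).
  rewrite horner_coef; apply: eq_bigr => i _.
  by rewrite exprMn -[RHS]/((z ^+ k) ^+ i * (P`_i * rc s ^+ i)); ring.
have NR : 0 < (N%:R : R) by rewrite ltr0n.
have : cmod (N%:R * (P`_m * rc s ^+ m)) <= N%:R * M.
  rewrite -e1 (le_trans (cmod_sum _ _ _)) //.
  have -> : N%:R * M = \sum_(0 <= k < N) M by rewrite sumr_const_nat subn0 mulr_natl.
  apply: ler_sum => k _; rewrite cmodM cmodV cmodX nk expr1n invr1 mulr1.
  by apply: hP; rewrite cmodM cmod_rc nk mulr1 ger0_norm.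
by rewrite !cmodM cmod_nat ler_pM2l // cmodX cmod_rc ger0_norm.
Qed.

Lemma geom_le2 (q : R) k : 0 <= q -> q <= 1 / 2 -> \sum_(0 <= i < k) q ^+ i <= 2.
Proof.
move=> q0 q2; have := subrX1 q k; rewrite -[X in _ * X](big_mkord xpredT (fun i => q ^+ i)).
set S := bigop _ _ _ => h; have := exprn_ge0 k q0.
have S0 : 0 <= S by apply: sumr_ge0 => i _; exact: exprn_ge0.
nra.
Qed.

(** By Cauchy's estimate the terms of degree at least 2 are dominated by a
    geometric series of ratio at most 1/2. *)
Lemma quad_bound P s M t : 0 < s -> (forall t, cmod t <= s -> cmod P.[t] <= M) ->
  2 * cmod t <= s -> cmod (P.[t] - P`_0 - P`_1 * t) <= 2 * M * (cmod t / s) ^+ 2.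
Proof.
move=> s0 hP ht; set q := cmod t / s.
have M0 : 0 <= M by apply: le_trans (hP 0 _); rewrite ?cmod0 ?cmod_ge0 // ltW.
have q0 : 0 <= q by rewrite divr_ge0 ?cmod_ge0 // ltW.
have q2 : q <= 1 / 2 by rewrite ler_pdivrMr //; lra.
have -> : P.[t] = \sum_(0 <= i < (size P).+2) P`_i * t ^+ i.
  by rewrite (@horner_coef_wide _ (size P).+2) ?big_mkord // (leq_trans (leqnSn _)).
rewrite 2?big_nat_recl // expr0 expr1 mulr1.
set T := bigop _ _ _; have -> : P`_0 + (P`_1 * t + T) - P`_0 - P`_1 * t = T by ring.
apply: (le_trans (cmod_sum _ _ _)).
apply: (@le_trans _ _ (\sum_(0 <= i < size P) M * q ^+ 2 * q ^+ i)); last first.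
  have Mq : 0 <= M * q ^+ 2 by rewrite mulr_ge0 // exprn_ge0.
  by rewrite -mulr_sumr; have := ler_wpM2l Mq (geom_le2 (size P) q0 q2); lra.
apply: ler_sum => i _.
have -> : cmod (P`_i.+2 * t ^+ i.+2) = cmod P`_i.+2 * s ^+ i.+2 * q ^+ i.+2.
  by rewrite cmodM cmodX /q expr_div_n -mulrA [s ^+ _ * _]mulrC divfK // expf_neq0 // gt_eqF.
have -> : M * q ^+ 2 * q ^+ i = M * q ^+ i.+2 by rewrite -mulrA -exprD.
by rewrite ler_wpM2r ?exprn_ge0 // coef_bound // ltW.
Qed.

Lemma poly_bounded P r : exists2 M, 0 <= M & forall t, cmod t <= r -> cmod P.[t] <= M.
Proof.
exists (\sum_(i < size P) cmod P`_i * `|r| ^+ i).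
  by apply: sumr_ge0 => i _; rewrite mulr_ge0 ?cmod_ge0 ?exprn_ge0.
move=> t ht; rewrite horner_coef (le_trans (cmod_sum _ _ _)) //.
apply: ler_sum => i _; rewrite cmodM cmodX ler_wpM2l ?cmod_ge0 // lerXn2r ?nnegrE ?cmod_ge0 //.
exact: (le_trans ht (ler_norm _)).
Qed.

Lemma coef1E P : P`_1 = P^`().[0].
Proof. by rewrite horner_coef0 coef_deriv mulr1n. Qed.

Lemma quad_bound_at P t h s M : 0 < s -> (forall t', cmod (t' - t) <= s -> cmod P.[t'] <= M) ->
  2 * cmod h <= s -> cmod (P.[t + h] - P.[t] - P^`().[t] * h) <= 2 * M * (cmod h / s) ^+ 2.
Proof.
move=> s0 hP hh; pose Q := P \Po ('X + t%:P).
have hQ : forall x, cmod x <= s -> cmod Q.[x] <= M.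
  move=> x hx; rewrite horner_comp !hornerE; apply: hP.
  by have -> : x + t - t = x by ring.
have := quad_bound s0 hQ hh.
rewrite coef1E /Q -[_`_0]horner_coef0 deriv_comp !(horner_comp, hornerE) derivD derivX derivC.
by rewrite !hornerE [h + t]addrC.
Qed.

(** The Cauchy condition for locally uniform convergence on C. *)
Definition lu_cauchy1 (P : nat -> {poly C R}) := forall r e, 0 < e ->
  exists N, forall n m, (N <= n)%N -> (N <= m)%N -> forall t, cmod t <= r ->
    cmod ((P n).[t] - (P m).[t]) <= e.

(** The P n converge to a primitive U of u. Near t the functions U and P n are
    affine up to errors that are uniform in n, which forces the slopes of P n to
    tend to the slope u t of U. *)
Theorem entire_approx (u : C R -> C R) : (forall t, differentiable u t) ->
  exists2 P : nat -> {poly C R}, lu_cauchy1 P & forall t, (fun n => (P n)^`().[t]) @ \oo --> u t.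
Proof.
move=> ud; have [U hU] := primitive ud.
have /choice[P hP] : forall n : nat, exists P : {poly C R}, forall w, cmod w <= n%:R ->
    cmod (P.[w] - U w) <= n.+1%:R^-1.
  by move=> n; apply: poly_approx hU _ _ _; rewrite invr_gt0 ltr0n.
have hPU r e : 0 < e -> exists N, forall n, (N <= n)%N -> forall t, cmod t <= r ->
    cmod ((P n).[t] - U t) <= e.
  move=> e0; exists (Num.bound `|r| + Num.bound e^-1)%N => n hn t ht.
  have h1 : cmod t <= n%:R.
    apply: (le_trans ht); apply: (le_trans (ler_norm _)); apply: ltW.
    apply: (lt_le_trans (archi_boundP (normr_ge0 r))); rewrite ler_nat.
    exact: leq_trans (leq_addr _ _) hn.
  apply: (le_trans (hP n t h1)); rewrite -[leRHS]invrK lef_pV2 ?posrE ?ltr0n ?invr_gt0 //.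
  have i0 : 0 <= e^-1 by rewrite invr_ge0 ltW.
  apply: ltW; apply: (lt_le_trans (archi_boundP i0)); rewrite ler_nat.
  exact: leq_trans (leq_trans (leq_addl _ _) hn) (leqnSn _).
have lP : lu_cauchy1 P.
  move=> r e e0; have e2 : 0 < e / 2 by rewrite divr_gt0.
  have [N hN] := hPU r _ e2; exists N => n m /hN hn /hN hm t ht.
  by have := cmod_dist (P n).[t] (P m).[t] (U t); rewrite (cmodC (U t)); have := hn t ht;
    have := hm t ht; lra.
exists P => // t; apply/cmod_cvg => e e0.
pose r := cmod t + 1; have r0 : 0 <= r by have := cmod_ge0 t; rewrite /r; lra.
have [N0 hN0] := lP r 1 ltr01.
have [M0 M00 hM0] := poly_bounded (P N0) r.
have hM n : (N0 <= n)%N -> forall x, cmod (x - t) <= 1 -> cmod (P n).[x] <= M0 + 1.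
  move=> hn x hx; have hxr : cmod x <= r by have := cmodD (x - t) t; rewrite subrK /r; lra.
  have := hN0 n N0 hn (leqnn _) x hxr; have := hM0 x hxr.
  by have := cmodD ((P n).[x] - (P N0).[x]) (P N0).[x]; rewrite subrK; lra.
have e8 : 0 < e / 8 by rewrite divr_gt0.
have [del d0 hdel] := hU r _ e8.
(* k is short enough for U, for Cauchy's estimate at radius 1, and for the
   quadratic error 2 (M0 + 1) k^2 to be at most e k / 8 *)
pose k := Num.min (Num.min (del / 2) (1 / 2)) (e / (16 * (M0 + 1))).
have M1 : 0 < M0 + 1 by lra.
have k0 : 0 < k by rewrite !lt_min !divr_gt0 // mulr_gt0.
have kdel : k < del by apply: (@le_lt_trans _ _ (del / 2)); [rewrite !ge_min lexx|lra].
have k12 : k <= 1 / 2 by rewrite !ge_min lexx orbT.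
have kM : (M0 + 1) * k <= e / 16.
  have : k <= e / (16 * (M0 + 1)) by rewrite !ge_min lexx orbT.
  rewrite invfM mulrA ler_pdivlMr // => h; lra.
have ke : 0 < e * k / 8 by rewrite divr_gt0 // mulr_gt0.
have [N1 hN1] := hPU r _ ke.
exists (N0 + N1)%N => n hn.
have hn0 := leq_trans (leq_addr _ _) hn; have hn1 := leq_trans (leq_addl _ _) hn.
have tr : cmod t <= r by rewrite /r; lra.
have nk : cmod (rc k) = k by rewrite cmod_rc gtr0_norm.
have tkr : cmod (t + rc k) <= r by have := cmodD t (rc k); rewrite nk /r; lra.
have h1 := hN1 n hn1 _ tr; have h2 := hN1 n hn1 _ tkr.
have := hdel (t + rc k) t tkr tr; have -> : t + rc k - t = rc k by ring.
rewrite nk => /(_ kdel) h3.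
have := @quad_bound_at (P n) t (rc k) 1 (M0 + 1) ltr01 (hM n hn0).
rewrite nk divr1 => h4; have {}h4 := h4 (ltac:(lra)).
have h5 : cmod (((P n)^`().[t] - u t) * rc k) < e * k.
  have -> : ((P n)^`().[t] - u t) * rc k = (U (t + rc k) - U t - u t * rc k)
    - ((P n).[t + rc k] - (P n).[t] - (P n)^`().[t] * rc k)
    + (((P n).[t + rc k] - U (t + rc k)) - ((P n).[t] - U t)) by ring.
  move: h1 h2 h3 h4.
  set x1 := U _ - _ - _; set x2 := (P n).[_] - _ - _; set x3 := (P n).[_] - U _;
    set x4 := (P n).[_] - U _.
  move=> h1 h2 h3 h4.
  have := cmodD (x1 - x2) (x4 - x3); have := cmodB x1 x2; have := cmodB x4 x3; have := cmodB x3 x4.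
  have := ler_wpM2r (ltW k0) kM; have := mulr_gt0 e0 k0.
  rewrite expr2 in h4; rewrite (cmodC x3 x4); lra.
by move: h5; rewrite cmodM nk ltr_pM2r.
Qed.

End PolyBounds.

(** * Polynomials on C^3 and their locally uniform limits *)

Section Pol.
Variable R : realType.
Local Notation K := (C R).
Implicit Types (v h : 'rV[K]_3) (q : {poly K}) (a b c t : K) (r e s : R).

(** Polynomials in x, y and z, represented by expressions so that partial
    derivatives and evaluations, in C or along a polynomial curve, are defined
    by recursion. *)
Inductive pol :=
  | QX of {poly K} | QY of {poly K} | QZ of {poly K}
  | Add of pol & pol | Mul of pol & pol.
Implicit Types f g : pol.

Fixpoint ev (x y z : K) f : K :=
  match f with
  | QX q => q.[x] | QY q => q.[y] | QZ q => q.[z]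
  | Add f g => ev x y z f + ev x y z g
  | Mul f g => ev x y z f * ev x y z g
  end.

Fixpoint evP (x y z : {poly K}) f : {poly K} :=
  match f with
  | QX q => q \Po x | QY q => q \Po y | QZ q => q \Po z
  | Add f g => evP x y z f + evP x y z g
  | Mul f g => evP x y z f * evP x y z g
  end.

(** Partial derivatives; d = 0, 1, 2 stands for x, y, z. *)
Fixpoint dif (d : nat) f : pol :=
  match f with
  | QX q => QX (if d is 0%N then q^`() else 0)
  | QY q => QY (if d is 1%N then q^`() else 0)
  | QZ q => QZ (if d is 2%N then q^`() else 0)
  | Add f g => Add (dif d f) (dif d g)
  | Mul f g => Add (Mul (dif d f) g) (Mul f (dif d g))
  end.

Notation dx := (dif 0).
Notation dy := (dif 1).
Notation dz := (dif 2).

Definition at_pt f v := ev (xc v) (yc v) (zc v) f.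

Lemma evP_horner (x y z : {poly K}) f t : (evP x y z f).[t] = ev x.[t] y.[t] z.[t] f.
Proof. by elim: f => [q|q|q|f IHf g IHg|f IHf g IHg] /=;
  rewrite ?horner_comp // hornerE IHf IHg. Qed.

Lemma deriv_evP (x y z : {poly K}) f : (evP x y z f)^`() =
  x^`() * evP x y z (dx f) + y^`() * evP x y z (dy f) + z^`() * evP x y z (dz f).
Proof.
elim: f => [q|q|q|f IHf g IHg|f IHf g IHg] /=.
- by rewrite deriv_comp !comp_poly0; ring.
- by rewrite deriv_comp !comp_poly0; ring.
- by rewrite deriv_comp !comp_poly0; ring.
- by rewrite derivD IHf IHg; ring.
- by rewrite derivM IHf IHg; ring.
Qed.

Lemma ev_difC d d' x y z f : ev x y z (dif d (dif d' f)) = ev x y z (dif d' (dif d f)).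
Proof.
elim: f => [q|q|q|f IHf g IHg|f IHf g IHg] /=.
- by case: d d' => [|d] [|d'] //=; rewrite ?deriv0.
- by case: d d' => [|[|d]] [|[|d']] //=; rewrite ?deriv0.
- by case: d d' => [|[|[|d]]] [|[|[|d']]] //=; rewrite ?deriv0.
- by rewrite IHf IHg.
- by rewrite IHf IHg; ring.
Qed.

Definition dirv h f : pol :=
  Add (Mul (QZ (xc h)%:P) (dx f)) (Add (Mul (QZ (yc h)%:P) (dy f)) (Mul (QZ (zc h)%:P) (dz f))).

Lemma at_pt_dirv f h v : at_pt (dirv h f) v =
  xc h * at_pt (dx f) v + yc h * at_pt (dy f) v + zc h * at_pt (dz f) v.
Proof. by rewrite /at_pt /= !hornerC addrA. Qed.

(** The restriction to a parametrized line is a polynomial in one variable: this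
    is how estimates on C^3 are reduced to those on C. *)
Definition line f v h : {poly K} :=
  evP ((xc v)%:P + xc h *: 'X) ((yc v)%:P + yc h *: 'X) ((zc v)%:P + zc h *: 'X) f.

Lemma line_horner f v h t : (line f v h).[t] = at_pt f (v + t *: h).
Proof.
rewrite evP_horner /at_pt /xc /yc /zc !hornerE !mxE.
by rewrite (mulrC t (h 0 0)) (mulrC t (h 0 1)) (mulrC t (h 0 2)).
Qed.

Lemma line0 f v h : (line f v h)`_0 = at_pt f v.
Proof. by rewrite -horner_coef0 line_horner scale0r addr0. Qed.

Lemma line1 f v h : (line f v h)`_1 = at_pt (dirv h f) v.
Proof.
rewrite coef1E deriv_evP !derivD !derivC !derivZ !derivX !add0r !hornerE !evP_horner !hornerE.
by rewrite at_pt_dirv /at_pt.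
Qed.

Definition polydisc v r := forall i, cmod (v 0 i) <= r.

Lemma polydiscD v h r s : polydisc v r -> polydisc h s -> polydisc (v + h) (r + s).
Proof. by move=> hv hh i; rewrite mxE (le_trans (cmodD _ _)) // lerD. Qed.

Lemma polydiscZ t h s : polydisc h s -> polydisc (t *: h) (cmod t * s).
Proof. by move=> hh i; rewrite mxE cmodM ler_wpM2l ?cmod_ge0. Qed.

Lemma pol_bounded f r : exists2 M, 0 <= M & forall v, polydisc v r -> cmod (at_pt f v) <= M.
Proof.
elim: f => [q|q|q|f [M M0 hM] g [N N0 hN]|f [M M0 hM] g [N N0 hN]].
- by have [M M0 hM] := poly_bounded q r; exists M => // v hv; apply: hM; exact: hv.
- by have [M M0 hM] := poly_bounded q r; exists M => // v hv; apply: hM; exact: hv.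
- by have [M M0 hM] := poly_bounded q r; exists M => // v hv; apply: hM; exact: hv.
- exists (M + N); first exact: addr_ge0.
  by move=> v hv; rewrite /at_pt /= (le_trans (cmodD _ _)) // lerD // ?hM ?hN.
- exists (M * N); first exact: mulr_ge0.
  by move=> v hv; rewrite /at_pt /= cmodM ler_pM ?cmod_ge0 // ?hM ?hN.
Qed.

(** Cauchy's estimate for the linear coefficient on the line through v directed
    by h. *)
Lemma dif_bound f v r M h : (forall w, polydisc w (r + 1) -> cmod (at_pt f w) <= M) ->
  polydisc v r -> polydisc h 1 ->
  cmod (at_pt (dirv h f) v) <= M.
Proof.
move=> hM hv hh; rewrite -line1; have := @coef_bound R (line f v h) 1 M 1 ler01.
rewrite expr1 mulr1; apply => t ht; rewrite line_horner; apply: hM; apply: polydiscD => // i.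
by apply: le_trans (polydiscZ t hh i) _; rewrite mulr1.
Qed.

(** On the line through v directed by h the bound M holds up to parameters of
    modulus 1 / s, so that quad_bound applies at the parameter 1. *)
Lemma quad_bound_pol f v r M h s : (forall w, polydisc w (r + 1) -> cmod (at_pt f w) <= M) ->
  polydisc v r -> polydisc h s ->
  0 < s -> 2 * s <= 1 ->
  cmod (at_pt f (v + h) - at_pt f v - at_pt (dirv h f) v) <= 2 * M * s ^+ 2.
Proof.
move=> hM hv hh s0 s1.
have := @quad_bound R (line f v h) s^-1 M 1; rewrite invr_gt0 => /(_ s0).
rewrite line_horner line0 line1 scale1r mulr1 cmod1 div1r invrK; apply.
  move=> t ht; rewrite line_horner; apply: hM; apply: polydiscD => // i.
  apply: le_trans (polydiscZ t hh i) _; have := ler_wpM2r (ltW s0) ht.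
  by rewrite mulVf // gt_eqF.
by rewrite -[leRHS]mul1r ler_pdivlMr // mulr1.
Qed.

(** The Cauchy condition for locally uniform convergence on C^3. By
    lu_cauchy_dif it is inherited by all derivatives. *)
Definition lu_cauchy (F : nat -> pol) := forall r e, 0 < e ->
  exists N, forall n m, (N <= n)%N -> (N <= m)%N -> forall v, polydisc v r ->
    cmod (at_pt (F n) v - at_pt (F m) v) <= e.

Lemma lu_cauchy_cst f : lu_cauchy (fun=> f).
Proof. by move=> r e e0; exists 0%N => n m _ _ v _; rewrite subrr cmod0 ltW. Qed.

Lemma lu_cauchy_bounded F r : lu_cauchy F -> exists N, exists2 M, 0 <= M &
  forall n, (N <= n)%N -> forall v, polydisc v r -> cmod (at_pt (F n) v) <= M.
Proof.
move=> /(_ r 1 ltr01)[N hN]; have [M M0 hM] := pol_bounded (F N) r.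
exists N, (M + 1); first lra.
move=> n hn v hv; have := hN n N hn (leqnn _) v hv; have := hM v hv.
by have := cmodD (at_pt (F n) v - at_pt (F N) v) (at_pt (F N) v); rewrite subrK; lra.
Qed.

Lemma lu_cauchy_add F G : lu_cauchy F -> lu_cauchy G -> lu_cauchy (fun n => Add (F n) (G n)).
Proof.
move=> hF hG r e e0; have e2 : 0 < e / 2 by rewrite divr_gt0.
have [N hN] := hF r _ e2; have [M hM] := hG r _ e2.
exists (maxn N M) => n m; rewrite !geq_max => /andP[n1 n2] /andP[m1 m2] v hv.
have := hN n m n1 m1 v hv; have := hM n m n2 m2 v hv; rewrite {5 6}/at_pt /=.
rewrite -!/(at_pt _ _) => h1 h2.
have -> : at_pt (F n) v + at_pt (G n) v - (at_pt (F m) v + at_pt (G m) v) =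
  (at_pt (F n) v - at_pt (F m) v) + (at_pt (G n) v - at_pt (G m) v) by ring.
have := cmodD (at_pt (F n) v - at_pt (F m) v) (at_pt (G n) v - at_pt (G m) v); lra.
Qed.

Lemma lu_cauchy_mul F G : lu_cauchy F -> lu_cauchy G -> lu_cauchy (fun n => Mul (F n) (G n)).
Proof.
move=> hF hG r e e0.
have [N1 [B B0 hB]] := lu_cauchy_bounded r hF; have [N2 [D D0 hD]] := lu_cauchy_bounded r hG.
have e2 : 0 < e / (2 * (B + D + 1)) by rewrite divr_gt0 // mulr_gt0 //; lra.
have [N hN] := hF r _ e2; have [M hM] := hG r _ e2.
exists (maxn (maxn N1 N2) (maxn N M)) => n m; rewrite !geq_max.
move=> /andP[/andP[n1 n2] /andP[n3 n4]] /andP[/andP[m1 m2] /andP[m3 m4]] v hv.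
have h1 := hN n m n3 m3 v hv; have h2 := hM n m n4 m4 v hv.
have h3 := hB n n1 v hv; have h4 := hD m m2 v hv.
have -> : at_pt (Mul (F n) (G n)) v - at_pt (Mul (F m) (G m)) v =
  at_pt (F n) v * (at_pt (G n) v - at_pt (G m) v) + (at_pt (F n) v - at_pt (F m) v) * at_pt (G m) v.
  by rewrite /at_pt /=; ring.
apply: (le_trans (cmodD _ _)); rewrite !cmodM.
have k1 := ler_pM (cmod_ge0 _) (cmod_ge0 _) h3 h2.
have k2 := ler_pM (cmod_ge0 _) (cmod_ge0 _) h1 h4.
apply: (le_trans (lerD k1 k2)).
have p : 0 < B + D + 1 by lra.
have -> : B * (e / (2 * (B + D + 1))) + e / (2 * (B + D + 1)) * D = e * ((B + D) / (2 * (B + D +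
  1))).
  by field; rewrite gt_eqF.
rewrite ger_pMr // ler_pdivrMr ?mulr_gt0 //; lra.
Qed.

Lemma xcE (a b c : K) : xc (vec3 a b c) = a. Proof. by rewrite /xc mxE. Qed.
Lemma ycE (a b c : K) : yc (vec3 a b c) = b. Proof. by rewrite /yc mxE. Qed.
Lemma zcE (a b c : K) : zc (vec3 a b c) = c. Proof. by rewrite /zc mxE. Qed.

Lemma ord3_case (P : 'I_3 -> Prop) : P 0 -> P 1 -> P 2 -> forall i, P i.
Proof.
move=> h0 h1 h2 [[|[|[|//]]] hi].
- by rewrite (_ : Ordinal hi = 0) //; apply: val_inj.
- by rewrite (_ : Ordinal hi = 1) //; apply: val_inj.
- by rewrite (_ : Ordinal hi = 2) //; apply: val_inj.
Qed.

Lemma dif_bound1 d f v r M : (forall w, polydisc w (r + 1) -> cmod (at_pt f w) <= M) ->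
  polydisc v r ->
  0 <= M -> cmod (at_pt (dif d f) v) <= M.
Proof.
move=> hM hv M0.
have hd (a b c : K) : polydisc (vec3 a b c) 1 ->
    cmod (a * at_pt (dx f) v + b * at_pt (dy f) v + c * at_pt (dz f) v) <= M.
  by move=> h1; have := dif_bound hM hv h1; rewrite at_pt_dirv xcE ycE zcE.
case: d => [|[|[|d]]].
- have := hd 1 0 0; rewrite mul1r !mul0r !addr0; apply.
  by apply: ord3_case; rewrite mxE /= ?cmod1 ?cmod0.
- have := hd 0 1 0; rewrite mul1r !mul0r addr0 add0r; apply.
  by apply: ord3_case; rewrite mxE /= ?cmod1 ?cmod0.
- have := hd 0 0 1; rewrite mul1r !mul0r !add0r; apply.
  by apply: ord3_case; rewrite mxE /= ?cmod1 ?cmod0.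
- suff -> : at_pt (dif d.+3 f) v = 0 by rewrite cmod0.
  rewrite /at_pt; elim: f {hM hd} => [q|q|q|f IHf g IHg|f IHf g IHg] /=; rewrite ?horner0 //.
    by rewrite IHf IHg addr0.
  by rewrite IHf IHg mul0r mulr0 addr0.
Qed.

Lemma lu_cauchy_dif d F : lu_cauchy F -> lu_cauchy (fun n => dif d (F n)).
Proof.
move=> hF r e e0; have [N hN] := hF (r + 1) e e0.
exists N => n m hn hm v hv.
pose D := Add (F n) (Mul (QZ (-1)%:P) (F m)).
have DE w : at_pt D w = at_pt (F n) w - at_pt (F m) w by rewrite /at_pt /= hornerC mulN1r.
have -> : at_pt (dif d (F n)) v - at_pt (dif d (F m)) v = at_pt (dif d D) v.
  rewrite /at_pt /= hornerC mulN1r (_ : (if d is 2%N then _ else _) = 0) ?horner0 ?mul0r ?add0r //.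
  by case: d => [|[|[|d]]] //; rewrite derivC.
apply: dif_bound1 hv (ltW e0) => w hw; rewrite DE; exact: hN.
Qed.

Lemma lu_cauchy_QX P : lu_cauchy1 P -> lu_cauchy (fun n => QX (P n)).
Proof. by move=> hP r e /(hP r)[N hN]; exists N => n m hn hm v hv; apply: hN => //; exact: hv. Qed.

Lemma lu_cauchy_QY P : lu_cauchy1 P -> lu_cauchy (fun n => QY (P n)).
Proof. by move=> hP r e /(hP r)[N hN]; exists N => n m hn hm v hv; apply: hN => //; exact: hv. Qed.

Lemma polydisc_ex v : exists r, polydisc v r.
Proof.
exists (cmod (v 0 0) + cmod (v 0 1) + cmod (v 0 2)); have := cmod_ge0 (v 0 0);
  have := cmod_ge0 (v 0 1).
have := cmod_ge0 (v 0 2); move=> h2 h1 h0.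
by apply: ord3_case; lra.
Qed.

Lemma lu_cauchy_cvg F v : lu_cauchy F -> exists l : K, (fun n => at_pt (F n) v) @ \oo --> l.
Proof.
move=> hF; apply: cmod_cauchy => e e0; have [r hr] := polydisc_ex v.
have e2 : 0 < e / 2 by rewrite divr_gt0.
have [N hN] := hF r _ e2; exists N => n m hn hm.
by apply: (le_lt_trans (hN n m hn hm v hr)); lra.
Qed.

End Pol.
Notation dx := (dif 0).
Notation dy := (dif 1).
Notation dz := (dif 2).

(** * Locally uniform limits are differentiable *)

Section Limit.
Variable R : realType.
Local Notation K := (C R).
Implicit Types (v h : 'rV[K]_3) (r e s : R).

Definition nv v : R := complex.Re `|v|.

Lemma nvE v : `|v| = rc (nv v).
Proof. by rewrite /nv /rc (@RRe_real _ (`|v| : R[i])) //; apply: ger0_real; exact: normr_ge0. Qed.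

Lemma nv_ge0 v : 0 <= nv v.
Proof. by rewrite -rc_le -nvE normr_ge0. Qed.

Lemma nv_polydisc v s : 0 <= s -> (nv v <= s) <-> polydisc v s.
Proof.
move=> s0; rewrite -rc_le -nvE; split=> [h i|h].
  rewrite -rc_le -cmodE; apply: le_trans h.
  by rewrite [leRHS]/Num.Def.normr /= mx_normE -[leLHS]nngE num_le; exact: (le_bigmax _ _ (0, i)).
have [->|] := eqVneq `|v| 0; first by rewrite -[0]/(rc 0) rc_le.
rewrite {1 2}/Num.Def.normr /= => /mx_norm_neq0[[i j] ->] /=.
by rewrite cmodE rc_le (ord1 i).
Qed.

Lemma polydisc_nv v : polydisc v (nv v).
Proof. exact/(nv_polydisc _ (nv_ge0 v)). Qed.

Lemma near_nv v (A : set 'rV[K]_3) :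
  nbhs v A <-> exists2 d : R, 0 < d & forall w, nv (w - v) < d -> A w.
Proof.
split=> [/nbhs_ballP[e /= /pos_rc[d d0 ->]] h|[d d0 h]].
  by exists d => // t ht; apply: h; rewrite -ball_normE /ball_ /= distrC nvE rc_lt.
apply/nbhs_ballP; exists (rc d) => /=; first by rewrite rc_gt0.
by move=> t; rewrite -ball_normE /ball_ /= distrC nvE rc_lt; exact: h.
Qed.

Lemma mulmxr_continuous (J : 'M[K]_3) : continuous (fun h : 'rV[K]_3 => h *m J).
Proof.
move=> v; apply: differentiable_continuous.
rewrite (_ : (fun _ => _) = \sum_(i < 3) (fun h : 'rV[K]_3 => h 0 i *: row i J)).
  apply: differentiable_sum => i; apply: differentiableZl.
  exact: differentiable_coord.
by apply/funext => h; rewrite mulmx_sum_row fct_sumE.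
Qed.

Lemma diff_of_littleo (L : numFieldType) (V W : normedModType L) (f : V -> W) (D : {linear V ->
  W}) x :
  continuous D ->
  (forall e : L, 0 < e -> \forall k \near (0 : V), `|f (k + x) - (f x + D k)| <= e * `|k|) ->
  differentiable f x /\ forall k, 'd f x k = D k.
Proof.
move=> hc hf.
have ho : f \o shift x = cst (f x) + D +o_ 0 id by apply/eqaddoP => e /hf.
have he := diff_unique hc ho.
by split; [apply/diff_locallyP; rewrite he; split|move=> k; rewrite he].
Qed.

(** A remainder of second order is negligible. Small h suffice, and only there
    are Cauchy's estimates available. *)
Lemma quad_diff (W : 'rV[K]_3 -> 'rV[K]_3) v (J : 'M[K]_3) (M : R) : 0 <= M ->
  (forall h s, polydisc h s -> 0 < s -> 2 * s <= 1 ->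
    polydisc (W (v + h) - W v - h *m J) (M * s ^+ 2)) ->
  differentiable W v /\ forall h, 'd W v h = h *m J.
Proof.
move=> M0 hW.
pose D : {linear 'rV[K]_3 -> 'rV[K]_3} := mulmxr J.
have hc : continuous D := @mulmxr_continuous J.
apply: (@diff_of_littleo _ _ _ W D v hc) => e /pos_rc[d d0 ->].
pose k := Num.min (1 / 2) (d / (M + 1)).
have M1 : 0 < M + 1 by lra.
have k0 : 0 < k by rewrite lt_min !divr_gt0.
apply/near_nv; exists k => // h; rewrite subr0 => hk.
rewrite !nvE -rcM rc_le.
have [hs0|hs] := eqVneq (nv h) 0.
  have -> : h = 0 by apply/normr0_eq0; rewrite nvE hs0.
  by rewrite linear0 add0r addr0 subrr /nv !normr0 /= mulr0.
have s0 : 0 < nv h by rewrite lt_neqAle eq_sym hs nv_ge0.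
have k1 : 2 * nv h <= 1.
  have : k <= 1 / 2 by rewrite ge_min lexx.
  lra.
have := hW h (nv h) (polydisc_nv h) s0 k1.
rewrite -nv_polydisc; last by rewrite mulr_ge0 // sqr_ge0.
rewrite opprD addrA [v + h]addrC => /le_trans; apply.
rewrite expr2 mulrA ler_pM2r //.
have : k <= d / (M + 1) by rewrite ge_min lexx orbT.
rewrite ler_pdivlMr // => kd.
have := ler_wpM2l M0 (ltW hk); nra.
Qed.

Lemma cvg_le (u : nat -> K) (l : K) (B : R) N : u @ \oo --> l ->
  (forall n, (N <= n)%N -> cmod (u n) <= B) -> cmod l <= B.
Proof.
move=> ul hB; apply/ler_addgt0Pr => e e0.
have /cmod_cvg/(_ _ e0)[M hM] := ul.
have := hM (N + M)%N (leq_addl _ _); have := hB (N + M)%N (leq_addr _ _).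
have := cmodD (u (N + M)%N) (l - u (N + M)%N); rewrite addrC subrK (cmodC l); lra.
Qed.

(** The second order remainders of the A i n at v are bounded uniformly in n
    (quad_bound_pol), and the bound passes to the limit. *)
Theorem lu_cauchy_limit (A : 'I_3 -> nat -> pol R) : (forall i, lu_cauchy (A i)) ->
  exists W : 'rV[K]_3 -> 'rV[K]_3,
  (forall v i, (fun n => at_pt (A i n) v) @ \oo --> W v 0 i) /\
  forall v, differentiable W v /\
    forall h i, (fun n => at_pt (dirv h (A i n)) v) @ \oo --> 'd W v h 0 i.
Proof.
move=> hA.
have /choice[w hw] : forall vi : 'rV[K]_3 * 'I_3, exists l : K,
  (fun n => at_pt (A vi.2 n) vi.1) @ \oo --> l.
  by move=> [v i]; exact: lu_cauchy_cvg.
have hd d i : lu_cauchy (fun n => dif d (A i n)) by exact: lu_cauchy_dif.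
have /choice[wx hx] : forall vi : 'rV[K]_3 * 'I_3, exists l : K,
  (fun n => at_pt (dx (A vi.2 n)) vi.1) @ \oo --> l.
  by move=> [v i]; exact: lu_cauchy_cvg (hd 0 i).
have /choice[wy hy] : forall vi : 'rV[K]_3 * 'I_3, exists l : K,
  (fun n => at_pt (dy (A vi.2 n)) vi.1) @ \oo --> l.
  by move=> [v i]; exact: lu_cauchy_cvg (hd 1 i).
have /choice[wz hz] : forall vi : 'rV[K]_3 * 'I_3, exists l : K,
  (fun n => at_pt (dz (A vi.2 n)) vi.1) @ \oo --> l.
  by move=> [v i]; exact: lu_cauchy_cvg (hd 2 i).
pose W v : 'rV[K]_3 := \row_i w (v, i).
pose J v : 'M[K]_3 := \matrix_(k, i) nth 0 [:: wx (v, i); wy (v, i); wz (v, i)] k.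
have JE h v i : (h *m J v) 0 i = xc h * wx (v, i) + yc h * wy (v, i) + zc h * wz (v, i).
  rewrite mxE !big_ord_recl big_ord0 !mxE /= addr0 addrA /xc /yc /zc.
  by congr (_ * _ + _ * _ + _ * _); congr (h _ _); apply: val_inj.
have cJ h v i : (fun n => at_pt (dirv h (A i n)) v) @ \oo --> (h *m J v) 0 i.
  rewrite JE (_ : (fun n => _) = fun n => xc h * at_pt (dx (A i n)) v + yc h * at_pt (dy (A i
    n)) v +
    zc h * at_pt (dz (A i n)) v); last by apply/funext => n; rewrite at_pt_dirv.
  apply: cvgD; first apply: cvgD.
  - by apply: cvgMr; exact: (hx (v, i)).
  - by apply: cvgMr; exact: (hy (v, i)).
  - by apply: cvgMr; exact: (hz (v, i)).
exists W; split=> [v i|v]; first by rewrite mxE; exact: (hw (v, i)).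
have [r hr] := polydisc_ex v.
have /choice[NM hNM] : forall i, exists NM : nat * R, 0 <= NM.2 /\ forall n, (NM.1 <= n)%N ->
   forall w, polydisc w (r + 1) -> cmod (at_pt (A i n) w) <= NM.2.
  by move=> i; have [N [M M0 hM]] := lu_cauchy_bounded (r + 1) (hA i); exists (N, M).
pose M := \sum_i (NM i).2.
have M0 : 0 <= M by apply: sumr_ge0 => i _; case: (hNM i).
have hM i : (NM i).2 <= M.
  by rewrite /M (bigD1 i) //= lerDl sumr_ge0 // => j _; case: (hNM j).
have [dW dE] : differentiable W v /\ forall h, 'd W v h = h *m J v.
  apply: (@quad_diff _ _ _ (2 * M)); first by rewrite mulr_ge0.
  move=> h s hs s0 s1 i.
  apply: (@cvg_le (fun n => at_pt (A i n) (v + h) - at_pt (A i n) v - at_pt (dirv h (A i n)) v)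
    _ _ (NM i).1).
    have -> : (W (v + h) - W v - h *m J v) 0 i = w (v + h, i) - w (v, i) - (h *m J v) 0 i.
      by rewrite !mxE.
    apply: cvgB; last exact: cJ.
    by apply: cvgB; [exact: (hw (v + h, i))|exact: (hw (v, i))].
  move=> n hn; apply: (@quad_bound_pol R _ v r) => //.
  by move=> u hu; apply: le_trans (hM i); case: (hNM i) => _; exact.
by split; [exact: dW|move=> h i; rewrite dE; exact: cJ].
Qed.

End Limit.

(** * Derivatives along the surface *)

Section Tangent.
Variable R : realType.
Local Notation K := (C R).
Variable p : {poly K}.
Implicit Types (q v h : 'rV[K]_3).

Lemma root_deriv_neq0 (a : K) : p != 0 -> (forall a, root p a -> mup a p = 1%N) ->
  p.[a] = 0 -> p^`().[a] != 0.
Proof.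
move=> p0 hp pa; apply/eqP => pa'.
have ra : root p a by apply/rootP.
have := hp a ra; have /factor_theorem[s hs] := ra.
have sa : s.[a] = 0.
  by move: pa'; rewrite hs derivM derivXsubC !hornerE subrr mulr0 add0r.
have /factor_theorem[s' hs'] : root s a by apply/rootP.
move=> h; have : (2 <= mup a p)%N.
  by rewrite mup_geq // hs hs' -mulrA -expr2 dvdp_mulIr.
by rewrite h.
Qed.

Lemma is_derive_hornerC (s : {poly K}) (x : K) : is_derive x (1 : K) (fun t => s.[t] : K) s^`().[x].
Proof.
elim/poly_ind: s => [|s c IH].
  rewrite deriv0 horner0 (_ : (fun t => _) = cst 0); first exact: is_derive_cst.
  by apply/funext => t; rewrite horner0.
rewrite (_ : (fun t => _) = (fun t => s.[t]) * id + cst c); last first.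
  by apply/funext => t; rewrite hornerMXaddC.
apply: (is_derive_eq (is_deriveD (is_deriveM IH (is_derive_id x (1 : K))) (is_derive_cst c x (1
  : K)))).
rewrite derivD derivM derivX derivC !(hornerD, hornerM, hornerX, hornerC) /=.
rewrite -![_ *: _]/(_ * _). ring.
Qed.

Lemma near_Dsurf (q : Dsurf p) (A : set (Dsurf p)) :
  nbhs q A <-> exists2 B : set 'rV[K]_3, nbhs (set_val q) B & forall r : Dsurf p,
    B (set_val r) -> A r.
Proof.
split.
  move=> [_ /= [[B oB <-] /= Bq sB]]; exists B => //.
  exact: open_nbhs_nbhs (conj oB Bq).
move=> [B nB hB]; have h := @initial_continuous (Dsurf p) _ set_val q B nB.
by apply: (@filterS _ (nbhs q) _ (set_val @^-1` B) A _ h) => r /= /hB.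
Qed.

Lemma DsurfP v : Dsurf p v -> exists q : Dsurf p, set_val q = v.
Proof. by move=> hv; exists (exist _ v (mem_set hv)). Qed.

Lemma Dsurf_val (q : Dsurf p) : Dsurf p (set_val q).
Proof. by case: q => v hv; exact: set_mem hv. Qed.

(** The curves used on the surface: the term k t *: e, flat to first order,
    bends the line w + t *: v into D_p. *)
Lemma diff_curve (V : normedModType K) (w v e : V) (k : K -> K) :
  differentiable k 0 -> 'd k 0 1 = 0 ->
  differentiable (fun t : K => w + t *: v + k t *: e) 0 /\
  'd (fun t : K => w + t *: v + k t *: e) 0 1 = v.
Proof.
move=> dk k0.
have did : differentiable (fun t : K => t) 0 by apply/derivable1_diffP; exact: derivable_id.
have d1 : differentiable (fun t : K => t *: v) 0 := differentiableZl v did.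
have d2 : differentiable (fun t : K => k t *: e) 0 := differentiableZl e dk.
have dw : differentiable (cst w : K -> V) 0 := differentiable_cst w 0.
have h1 : 'd (fun t : K => t *: v) 0 1 = v.
  rewrite -[RHS]scale1r -[in RHS](derive_id (0 : K) (1 : K)) (deriveE (1 : K) did).
  exact: (congr1 (fun f : K -> V => f 1) (diffZl v did)).
have h2 : 'd (fun t : K => k t *: e) 0 1 = 0.
  rewrite -[RHS](scale0r e) -[in RHS]k0.
  exact: (congr1 (fun f : K -> V => f 1) (diffZl e dk)).
have hw : 'd (cst w : K -> V) 0 1 = 0 := congr1 (fun f : K -> V => f 1) (diff_cst w 0).
rewrite (_ : (fun t : K => w + t *: v + k t *: e) =
  cst w + (fun t : K => t *: v) + (fun t : K => k t *: e)); last by [].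
move: (fun t : K => t *: v) (fun t : K => k t *: e) d1 d2 h1 h2 => F1 F2 d1 d2 h1 h2.
have d01 := differentiableD dw d1.
split; first exact: (differentiableD d01 d2).
have e1 : 'd (cst w + F1 + F2) 0 1 = 'd (cst w + F1) 0 1 + 'd F2 0 1.
  exact: (congr1 (fun f : K -> V => f 1) (diffD d01 d2)).
have e2 : 'd (cst w + F1) 0 1 = 'd (cst w : K -> V) 0 1 + 'd F1 0 1.
  exact: (congr1 (fun f : K -> V => f 1) (diffD dw d1)).
have e3 : 'd (cst w : K -> V) 0 1 + 'd F1 0 1 = 0 + v := congr2 (fun a b : V => a + b) hw h1.
have e4 := congr2 (fun a b : V => a + b) (etrans e2 e3) h2.
exact: (etrans e1 (etrans e4 (etrans (addr0 _) (add0r _)))).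
Qed.

Section Vanish.
Variables (W : normedModType K) (E : 'rV[K]_3 -> W) (q : Dsurf p).
Hypothesis dE : differentiable E (set_val q).
Hypothesis E0 : \forall r \near q, E (set_val r) = 0.

(** The chain rule, applied to a function that is zero along the curve. *)
Lemma vanish_curve (c : K -> 'rV[K]_3) : c 0 = set_val q -> differentiable c 0 ->
  (\forall t \near (0 : K), Dsurf p (c t)) -> 'd E (set_val q) ('d c 0 1) = 0.
Proof.
move=> c0 dc Dc.
have dE' : differentiable E (c 0) by rewrite c0.
rewrite -c0 -[LHS]/(('d E (c 0) \o 'd c 0) 1) -(diff_comp dc dE').
rewrite -deriveE; last exact: differentiable_comp.
rewrite (@near_eq_derive _ _ _ _ (cst 0)); first by rewrite derive_cst.
have [B nB hB] := (near_Dsurf q _).1 E0.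
have : \forall t \near (0 : K), B (c t).
  by apply: (differentiable_continuous dc); rewrite c0.
move=> nBc; near=> t; rewrite /= /cst.
have hD : Dsurf p (c t) by near: t.
have [r hr] := DsurfP hD.
by rewrite -hr; apply: hB; rewrite hr; near: t.
Unshelve. all: by end_near. Qed.

(** Where the coordinate i does not vanish the surface is a graph over the
    coordinates i and 2. The curve above the line directed by v has velocity v
    exactly when v is tangent. *)
Lemma vanish_chart (i j : 'I_3) (v : 'rV[K]_3) :
  (forall w : 'rV[K]_3, Dsurf p w <-> w 0 i * w 0 j = p.[w 0 2]) -> i != j -> i != 2 -> j != 2 ->
  set_val q 0 i != 0 ->
  set_val q 0 j * v 0 i + set_val q 0 i * v 0 j = p^`().[set_val q 0 2] * v 0 2 ->
  'd E (set_val q) v = 0.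
Proof.
move=> hD ij i2 j2; set w := set_val q => wi hv.
pose A := p \Po ((w 0 2)%:P + v 0 2 *: 'X).
pose B := (w 0 i)%:P + v 0 i *: 'X.
pose G := (w 0 j)%:P + v 0 j *: 'X.
have B0 : B.[0] != 0 by rewrite /B !hornerE.
pose k : K -> K := (fun t => A.[t]) * (fun t => (B.[t])^-1) + (- (fun t => G.[t])).
have dB := is_derive_hornerC B 0.
have diV : is_derive (0 : K) (1 : K) (fun t => (B.[t])^-1 : K) (- (B.[0]) ^- 2 *: B^`().[0]).
  apply: DeriveDef; first by apply: derivableV => //; exact: ex_derive.
  by rewrite deriveV // derive_val.
have dA := is_derive_hornerC A 0.
have dG := is_derive_hornerC G 0.
have wD : w 0 i * w 0 j = p.[w 0 2] by apply/hD; exact: Dsurf_val.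
have dk : is_derive (0 : K) (1 : K) k 0.
  apply: is_derive_eq; rewrite /A /B /G deriv_comp !derivD !derivC !derivZ !derivX !add0r.
  rewrite !(hornerE, horner_comp) /= -![_ *: _]/(_ * _) -wD.
  have -> : v 0 j = (p^`().[w 0 2] * v 0 2 - w 0 j * v 0 i) / w 0 i.
    by rewrite -hv addrC addKr mulrC mulKf.
  by field.
have k0 : k 0 = 0.
  by rewrite -[LHS]/(A.[0] * (B.[0])^-1 - G.[0]) /A /B /G !(horner_comp, hornerE) -wD; field.
have dkk : differentiable k 0 by apply/derivable1_diffP; exact: ex_derive.
pose e : 'rV[K]_3 := delta_mx 0 j.
pose c (t : K) : 'rV[K]_3 := w + t *: v + k t *: e.
have k1 : 'd k 0 1 = 0 by rewrite -(deriveE (1 : K) dkk) derive_val.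
have [dc cv] : differentiable c 0 /\ 'd c 0 1 = v := diff_curve w v e dkk k1.
have c0 : c 0 = set_val q by rewrite /c k0 !scale0r !addr0.
rewrite -cv; apply: (vanish_curve c0 dc).
have cB : {for (0:K), continuous (fun t => B.[t] : K)}.
  by apply: differentiable_continuous; apply/derivable1_diffP; exact: ex_derive.
have nB : \forall t \near (0 : K), B.[t] != 0 by exact: cvg_neq0 cB B0.
near=> t; apply/hD.
rewrite /c !mxE !eqxx /= (negPf ij) [2 == j]eq_sym (negPf j2) !mulr0 !addr0.
have Bt : B.[t] = w 0 i + t * v 0 i by rewrite /B !hornerE mulrC.
have At : A.[t] = p.[w 0 2 + t * v 0 2] by rewrite /A horner_comp !hornerE mulrC.
have Gt : G.[t] = w 0 j + t * v 0 j by rewrite /G !hornerE mulrC.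
have Bt0 : B.[t] != 0 by near: t.
rewrite -At -Gt -Bt -[k t]/(A.[t] * (B.[t])^-1 - G.[t]).
by field.
Unshelve. all: by end_near. Qed.

Hypothesis sep : forall a, p.[a] = 0 -> p^`().[a] != 0.

(** At a point with x = y = 0 the tangent plane is dz = 0, because p' is not
    zero there, and it is spanned by two lines contained in the surface. All
    other points are covered by vanish_chart. *)
Lemma vanish_tangent v : tangent p (set_val q) v -> 'd E (set_val q) v = 0.
Proof.
set w := set_val q => hv.
have [wx|wx] := eqVneq (w 0 0) 0; last first.
  by apply: (@vanish_chart 0 1).
have [wy|wy] := eqVneq (w 0 1) 0; last first.
  apply: (@vanish_chart 1 0) => //; last by rewrite addrC.
  by move=> u; rewrite /Dsurf /= mulrC.
have wp : p.[w 0 2] = 0 by have := Dsurf_val q; rewrite /Dsurf /= -/w /xc wx mul0r.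
have v2 : v 0 2 = 0.
  move: hv; rewrite /tangent /xc /yc /zc wx wy !mul0r addr0 => /esym/eqP.
  by rewrite mulf_eq0 (negPf (sep wp)) /= => /eqP.
have lin (i : 'I_3) : (i == 0) || (i == 1) -> 'd E w (delta_mx 0 i) = 0.
  move=> hi; pose u : 'rV[K]_3 := delta_mx 0 i.
  pose c (t : K) : 'rV[K]_3 := w + t *: u + cst 0 t *: u.
  have dk : differentiable (cst 0 : K -> K) 0 := differentiable_cst 0 0.
  have k1 : 'd (cst 0 : K -> K) 0 1 = 0 by rewrite -(deriveE (1 : K) dk) derive_cst.
  have [dc cv] : differentiable c 0 /\ 'd c 0 1 = u := diff_curve w u u dk k1.
  have c0 : c 0 = w by rewrite /c !scale0r !addr0.
  rewrite -/u -cv; apply: (vanish_curve c0 dc).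
  near=> t; rewrite /c /cst scale0r addr0 /Dsurf /= /xc /yc /zc !mxE wx wy.
  by case/orP: hi => /eqP ->; rewrite /= ?mulr0 ?addr0 ?mul0r ?mulr0 ?addr0 ?wp ?mulr0.
have -> : v = v 0 0 *: delta_mx 0 0 + v 0 1 *: delta_mx 0 1.
  rewrite {1}[v]row_sum_delta !big_ord_recl big_ord0 addr0.
  rewrite (_ : lift ord0 (lift ord0 ord0) = 2) ?v2 ?scale0r ?addr0; last exact: val_inj.
  by rewrite (_ : lift ord0 ord0 = 1) //; exact: val_inj.
by rewrite linearD !linearZ /= !lin // !scaler0 addr0.
Unshelve. all: by end_near. Qed.

End Vanish.

Hypothesis sep : forall a, p.[a] = 0 -> p^`().[a] != 0.

(** Two local extensions of F differ by a function that vanishes on the surface.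
    *)
Theorem tderive_ext (W : normedModType K) (F : Dsurf p -> W) (q : Dsurf p) G v :
  local_extension F q G -> tangent p (set_val q) v ->
  tderive F q v = 'd G (set_val q) v.
Proof.
move=> hG hv; rewrite /tderive.
have := @xgetPex _ (fun=> 0) _ (ex_intro _ G hG).
set H := xget _ _ => -[dH eH]; case: hG => dG eG.
have dHq := nbhs_singleton dH; have dGq := nbhs_singleton dG.
apply/eqP; rewrite -subr_eq0; apply/eqP.
have e1 : 'd (H - G) (set_val q) v = 'd H (set_val q) v - 'd G (set_val q) v.
  exact: (congr1 (fun f : 'rV[K]_3 -> W => f v) (diffB dHq dGq)).
apply: (etrans (esym e1)).
apply: vanish_tangent sep _ hv; first exact: differentiableB dHq dGq.
near=> r; rewrite -[LHS]/(H (set_val r) - G (set_val r)).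
rewrite (_ : H _ = F r); last by apply/esym; near: r.
rewrite (_ : G _ = F r); last by apply/esym; near: r.
by rewrite subrr.
Unshelve. all: by end_near. Qed.

End Tangent.

(** * A volume preserving rotation field *)

Section Coord.
Variables (L : numFieldType) (V : normedModType L).

Lemma coord_is_derive m n (G : V -> 'M[L]_(m, n)) (q h : V) i j :
  differentiable G q -> is_derive q h (fun v => G v i j : L) ('d G q h i j).
Proof.
move=> dG; have dc := (@diff_derivable _ _ _ G q h dG).
have hc : (fun t : L => t^-1 *: ((fun v => G v i j : L) (t *: h + q) - G q i j)) @ 0^' --> ('d G
  q h i j : L).
  rewrite -(@deriveE _ _ _ G q h dG) /derive.
  rewrite (_ : (fun t => _) = (fun M : 'M[L]_(m, n) => M i j : L) \o
     (fun t => t^-1 *: ((G \o shift q) (t *: h) - G q))); last first.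
    by apply/funext => t; rewrite /= !mxE.
  exact: (cvg_comp _ _ dc (@coord_continuous _ _ _ i j _)).
apply: DeriveDef; first by apply/cvg_ex; exists ('d G q h i j).
exact: cvg_lim hc.
Qed.

End Coord.

Section VolumePreserving.
Variable R : realType.
Local Notation K := (C R).
Variable p : {poly K}.
Hypothesis sep : forall a, p.[a] = 0 -> p^`().[a] != 0.
Implicit Types (q v h : 'rV[K]_3).

(** The field x d/dx - y d/dy generates the circle action (x, y, z) |-> (s x, y
    / s, z), and its Hamiltonian is - z. *)
Definition rot (v : 'rV[K]_3) : 'rV[K]_3 := vec3 (xc v) (- yc v) 0.
Definition rot_field (q : Dsurf p) : 'rV[K]_3 := rot (set_val q).

(** The weights of the circle action on the three coordinates; the default value
    0 is the weight of z. *)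
Definition sg (i : 'I_3) : K := nth 0 [:: 1; -1] i.

Lemma rotE v i : rot v 0 i = sg i * v 0 i.
Proof.
by move: i; apply: ord3_case; rewrite /rot /vec3 mxE /sg /= /xc /yc; ring.
Qed.

Lemma rot_diff v : differentiable rot v /\ forall h, 'd rot v h = rot h.
Proof.
have rE w : rot w = w *m diag_mx (\row_i sg i).
  by apply/rowP => i; rewrite rotE mul_mx_diag !mxE mulrC.
have [|d e] := @quad_diff _ rot v (diag_mx (\row_i sg i)) 0 (lexx _).
  move=> h s _ _ _ i; rewrite !rE mulmxDl -addrA -opprD subrr mxE cmod0.
  by rewrite mul0r.
by split => [|h]; [exact: d|rewrite e rE].
Qed.

Lemma rot_tangent (q : Dsurf p) : tangent p (set_val q) (rot_field q).
Proof. by rewrite /tangent /rot_field /rot xcE ycE zcE; ring. Qed.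

Lemma rot_field_ext (q : Dsurf p) : local_extension rot_field q rot.
Proof.
split; near=> v => //.
by have [] := rot_diff v.
Unshelve. all: by end_near. Qed.

Lemma rot_field_tderive (q : Dsurf p) v : tangent p (set_val q) v -> tderive rot_field q v = rot v.
Proof.
move=> hv; apply: (etrans (tderive_ext sep (rot_field_ext q) hv)).
by have [_ ->] := rot_diff (set_val q).
Qed.

(** The quotient rule for chart_form in a direction with i-th component u, where
    x9 is the coordinate i, x1, x2 and x3, x4 are the components of the two
    arguments and d1, d2, e1, e2 their derivatives. *)
Lemma chart_alg (s x1 x2 x3 x4 d1 d2 e1 e2 u x9 : K) : x9 != 0 ->
  s *: ((x1 * x4 - x2 * x3) *: (- x9 ^- 2 *: u) +
        x9^-1 *: ((x1 *: e2 + x4 *: d1) - (x2 *: e1 + x3 *: d2))) =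
  s * ((d1 * x4 + x1 * e2 - d2 * x3 - x2 * e1) / x9 - (x1 * x4 - x2 * x3) * u / x9 ^+ 2).
Proof. by move=> h; rewrite -![_ *: _]/(_ * _); field. Qed.

(** The quotient rule of chart_alg against the two bracket terms, for a field
    that multiplies the coordinate i by g and does not move z. *)
Lemma chart_alg2 (s x1 x2 x3 x4 d1 d2 e1 e2 g x9 : K) : x9 != 0 ->
  s * ((d1 * x4 + x1 * e2 - d2 * x3 - x2 * e1) / x9 - (x1 * x4 - x2 * x3) * (g * x9) / x9 ^+ 2)
  - s * (((d1 - g * x1) * x4 - (d2 - 0 * x2) * x3) / x9)
  - s * ((x1 * (e2 - 0 * x4) - x2 * (e1 - g * x3)) / x9) = 0.
Proof. by move=> h; field. Qed.

Lemma coordN (a : 'rV[K]_3) k : (- a) 0 k = - a 0 k.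
Proof. by rewrite mxE. Qed.

Lemma coordB (a b : 'rV[K]_3) k : (a - b) 0 k = a 0 k - b 0 k.
Proof. by rewrite !mxE. Qed.

Section Chart.
Variables (q : Dsurf p) (U V : Dsurf p -> 'rV[K]_3) (GU GV : 'rV[K]_3 -> 'rV[K]_3).
Hypothesis hU : local_extension U q GU.
Hypothesis hV : local_extension V q GV.
Hypothesis tU : tangent p (set_val q) (U q).
Hypothesis tV : tangent p (set_val q) (V q).

(** The volume form in the charts where x, respectively y, does not vanish, with
    i = 0, s = 1, respectively i = 1, s = -1. *)
Definition chart_form (i : 'I_3) (s : K) (w a b : 'rV[K]_3) : K :=
  s * ((a 0 i * b 0 2 - a 0 2 * b 0 i) / w 0 i).

(** In the chart the form is the product of d log w_i and dw_2 up to the sign s;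
    the rotation adds a constant to log w_i and fixes w_2. *)
Lemma Lie_derivative_chart (i : 'I_3) (s : K) : set_val q 0 i != 0 ->
  (forall a b, vol p (set_val q) a b = chart_form i s (set_val q) a b) ->
  (\forall r \near q, vol p (set_val r) (U r) (V r) = chart_form i s (set_val r) (U r) (V r)) ->
  Lie_derivative_vol (p := p) rot_field U V q = 0.
Proof.
move=> qi hvol hnear; set w := set_val q in qi hvol *.
have [dU eU] := hU; have [dV eV] := hV.
have dUq := nbhs_singleton dU; have dVq := nbhs_singleton dV.
have eUq := nbhs_singleton eU; have eVq := nbhs_singleton eV.
pose F (v : 'rV[K]_3) : K := chart_form i s v (GU v) (GV v).
pose th := rot_field q.
have tth : tangent p w th := rot_tangent q.
have AE : tderive U q th = 'd GU w th := tderive_ext sep hU tth.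
have BE : tderive V q th = 'd GV w th := tderive_ext sep hV tth.
have der (v u : 'rV[K]_3) : differentiable GU v -> differentiable GV v -> v 0 i != 0 ->
  is_derive v u F (s * (('d GU v u 0 i * GV v 0 2 + GU v 0 i * 'd GV v u 0 2
    - 'd GU v u 0 2 * GV v 0 i - GU v 0 2 * 'd GV v u 0 i) / v 0 i
    - (GU v 0 i * GV v 0 2 - GU v 0 2 * GV v 0 i) * u 0 i / (v 0 i) ^+ 2)).
  move=> hGU hGV vi.
  have U1 := coord_is_derive u 0 i hGU; have U2 := coord_is_derive u 0 2 hGU.
  have V1 := coord_is_derive u 0 i hGV; have V2 := coord_is_derive u 0 2 hGV.
  have X1 : is_derive v u (fun v : 'rV[K]_3 => v 0 i : K) (u 0 i).
    have did : differentiable (fun v : 'rV[K]_3 => v) v.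
      have [|d _] := @quad_diff _ (fun v => v) v 1%:M 0 (lexx _); last exact: d.
      by move=> h e _ _ _ k; rewrite mulmx1 -addrA -opprD subrr mxE cmod0 mul0r.
    have := coord_is_derive u 0 i did.
    by rewrite -(@deriveE _ _ _ _ v u did) derive_id.
  have X2 : is_derive v u (fun v : 'rV[K]_3 => (v 0 i)^-1 : K) (- (v 0 i) ^- 2 *: u 0 i).
    have dX : derivable (fun v : 'rV[K]_3 => v 0 i : K) v u := @ex_derive _ _ _ _ _ _ _ X1.
    apply: DeriveDef; first exact: derivableV vi dX.
    apply: (etrans (deriveV vi dX)); congr (_ *: _).
    exact: (@derive_val _ _ _ _ _ _ _ X1).
  have D1 := is_deriveB (is_deriveM U1 V2) (is_deriveM U2 V1).
  have D2 := is_deriveZ s (is_deriveM D1 X2).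
  exact: (is_derive_eq D2 (chart_alg s _ _ _ _ _ _ _ _ _ vi)).
have dF (v : 'rV[K]_3) : differentiable GU v -> differentiable GV v -> v 0 i != 0 ->
  differentiable F v.
  move=> hGU hGV vi.
  have cU k := differentiable_comp hGU (differentiable_coord (GU v) 0 k).
  have cV k := differentiable_comp hGV (differentiable_coord (GV v) 0 k).
  have d1 := differentiableM (cU i) (cV 2); have d2 := differentiableM (cU 2) (cV i).
  have d3 := differentiableV (differentiable_coord v 0 i) vi.
  exact: (differentiableZ s (differentiableM (differentiableB d1 d2) d3)).
have ci : (fun v : 'rV[K]_3 => v 0 i) @ w --> w 0 i by exact: coord_continuous.
have ni : \forall v \near w, (v : 'rV[K]_3) 0 i != 0 by exact: cvg_neq0 ci qi.
have hF : local_extension (fun r => vol p (set_val r) (U r) (V r) : K) q F.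
  split; near=> r.
    by apply: dF; near: r.
  rewrite (_ : vol _ _ _ _ = chart_form i s (set_val r) (U r) (V r)); last by near: r.
  rewrite /F (_ : GU _ = U r); last by apply/esym; near: r.
  by rewrite (_ : GV _ = V r); last by apply/esym; near: r.
have FE : tderive (fun r => vol p (set_val r) (U r) (V r) : K) q th = 'D_th F w.
  apply: (etrans (tderive_ext sep hF tth)); apply/esym; apply: deriveE.
  exact: dF.
have {}der := der w th dUq dVq qi.
have BU k : Lie_bracket rot_field U q 0 k = 'd GU w th 0 k - sg k * U q 0 k.
  apply: (etrans (coordB _ _ k)).
  exact: (congr2 (fun (a : 'rV[K]_3) (b : K) => a 0 k - b) AE (etrans (congr1 (fun a : 'rV[K]_3
    => a 0 k) (rot_field_tderive tU)) (rotE _ k))).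
have BV k : Lie_bracket rot_field V q 0 k = 'd GV w th 0 k - sg k * V q 0 k.
  apply: (etrans (coordB _ _ k)).
  exact: (congr2 (fun (a : 'rV[K]_3) (b : K) => a 0 k - b) BE (etrans (congr1 (fun a : 'rV[K]_3
    => a 0 k) (rot_field_tderive tV)) (rotE _ k))).
have dval := @derive_val _ _ _ _ _ _ _ der.
rewrite /Lie_derivative_vol -/w -/th.
move: (Lie_bracket rot_field U q) (Lie_bracket rot_field V q) BU BV => LU LV BU BV.
have -> : vol p w LU (V q) = chart_form i s w LU (V q) := hvol _ _.
have -> : vol p w (U q) LV = chart_form i s w (U q) LV := hvol _ _.
rewrite /chart_form (BU i) (BV i) (BU 2) (BV 2) (etrans FE dval) -eUq -eVq.
have -> : th 0 i = sg i * w 0 i := rotE _ _.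
have s2 : sg 2 = 0 by [].
rewrite s2; exact: chart_alg2.
Unshelve. all: by end_near. Qed.
End Chart.

Lemma near_coord_neq0 (q : Dsurf p) (i : 'I_3) : set_val q 0 i != 0 ->
  \forall r \near q, set_val (r : Dsurf p) 0 i != 0.
Proof.
move=> qi; apply/near_Dsurf; exists [set w : 'rV[K]_3 | w 0 i != 0] => //.
have ci : (fun v : 'rV[K]_3 => v 0 i) @ set_val q --> set_val q 0 i by exact: coord_continuous.
exact: cvg_neq0 ci qi.
Qed.

Lemma vol_chart_x (w a b : 'rV[K]_3) : w 0 0 != 0 -> vol p w a b = chart_form 0 1 w a b.
Proof. by move=> h; rewrite /vol /chart_form /xc /zc h mul1r. Qed.

(** Where both x and y are nonzero, tangency makes the two expressions of the
    form agree. *)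
Lemma vol_chart_y (w a b : 'rV[K]_3) : w 0 1 != 0 -> tangent p w a -> tangent p w b ->
  vol p w a b = chart_form 1 (-1) w a b.
Proof.
rewrite /tangent /vol /chart_form /xc /yc /zc => h ta tb.
have [x0|x0] := eqVneq (w 0 0) 0; first by rewrite /= h mulN1r.
rewrite /=; apply: (mulIf (mulf_neq0 x0 h)).
transitivity (w 0 1 * a 0 0 * b 0 2 - w 0 1 * b 0 0 * a 0 2); first by field.
have -> : w 0 1 * a 0 0 = p^`().[w 0 2] * a 0 2 - w 0 0 * a 0 1 by rewrite -ta addrK.
have -> : w 0 1 * b 0 0 = p^`().[w 0 2] * b 0 2 - w 0 0 * b 0 1 by rewrite -tb addrK.
by field.
Qed.

(** The charts x != 0 and y != 0 are covered by Lie_derivative_chart. At the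
    remaining points the field vanishes, and only its linear part, of trace zero
    on the tangent plane, contributes. *)
Theorem rot_field_volume_preserving : volume_preserving p rot_field.
Proof.
split=> [q|q U V [[GU hU] tU] [[GV hV] tV]].
  split; first by exists rot; exact: rot_field_ext.
  by near=> r; exact: rot_tangent.
have tUq := nbhs_singleton tU; have tVq := nbhs_singleton tV.
have [x0|x0] := eqVneq (set_val q 0 0) 0; last first.
  apply: (Lie_derivative_chart hU hV tUq tVq (i := 0) (s := 1) x0).
    by move=> a b; exact: vol_chart_x.
  have nx := near_coord_neq0 x0.
  by near=> r; apply: vol_chart_x; near: r.
have [y0|y0] := eqVneq (set_val q 0 1) 0; last first.
  apply: (Lie_derivative_chart hU hV tUq tVq (i := 1) (s := -1) y0).
    by move=> a b; rewrite /vol /chart_form /xc /yc /zc x0 eqxx /= y0 mulN1r.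
  have ny := near_coord_neq0 y0.
  near=> r; apply: vol_chart_y; first by near: r.
  - by near: r; exact: tU.
  - by near: r; exact: tV.
have th0 : rot_field q = 0.
  by apply/rowP; apply: ord3_case; rewrite /rot_field rotE ?x0 ?y0 [RHS]mxE ?mulr0 // mul0r.
have td0 (W : normedModType K) (F : Dsurf p -> W) : tderive F q (rot_field q) = 0.
  by rewrite th0 /tderive linear0.
have BU : Lie_bracket rot_field U q = - rot (U q).
  exact: (etrans (congr2 (fun a b : 'rV[K]_3 => a - b) (td0 _ U) (rot_field_tderive tUq)) (sub0r
    _)).
have BV : Lie_bracket rot_field V q = - rot (V q).
  exact: (etrans (congr2 (fun a b : 'rV[K]_3 => a - b) (td0 _ V) (rot_field_tderive tVq)) (sub0r
    _)).
rewrite /Lie_derivative_vol BU BV.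
apply: (etrans (congr1 (fun a : K => a - _ - _) (td0 _ _))).
rewrite /vol /xc /yc /zc x0 y0 eqxx.
rewrite [~~ true]/=.
rewrite !coordN !rotE [sg 0]/(1 : K) [sg 1]/(-1 : K).
have E (a b c d e : K) : 0 - (- (1 * a) * b - - (-1 * c) * d) / e
    - (a * - (-1 * b) - c * - (1 * d)) / e = 0 by ring.
exact: E.
Unshelve. all: by end_near. Qed.

End VolumePreserving.

(** * Limits of Hamiltonian fields form a Lie algebra *)

Section Ham.
Variable R : realType.
Local Notation K := (C R).
Local Notation pol := (pol R).
Variable p : {poly K}.
Implicit Types (f g : pol) (v h : 'rV[K]_3).

(** The field of f is {f, -} for the bracket with {x, y} = p', {x, z} = x and
    {y, z} = - y on C^3. The function x y - p(z) is a Casimir of this bracket,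
    so the fields are tangent to D_p. The fields of functions of x alone, or of
    y alone, are the shear fields. *)
Definition vf1 f : pol := Mul (QZ (-1)%:P) (Add (Mul (QZ p^`()) (dy f)) (Mul (QX 'X) (dz f))).
Definition vf2 f : pol := Add (Mul (QZ p^`()) (dx f)) (Mul (QY 'X) (dz f)).
Definition vf3 f : pol := Add (Mul (QX 'X) (dx f)) (Mul (QZ (-1)%:P) (Mul (QY 'X) (dy f))).
Definition vf (i : 'I_3) f : pol := nth (QZ 0) [:: vf1 f; vf2 f; vf3 f] i.
Definition ham f v : 'rV[K]_3 := vec3 (at_pt (vf1 f) v) (at_pt (vf2 f) v) (at_pt (vf3 f) v).

Definition poisson f g : pol :=
  Add (Mul (vf1 f) (dx g)) (Add (Mul (vf2 f) (dy g)) (Mul (vf3 f) (dz g))).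

Lemma vf1E f v : at_pt (vf1 f) v = - (p^`().[zc v] * at_pt (dy f) v + xc v * at_pt (dz f) v).
Proof. by rewrite /at_pt /= ?hornerX ?horner0 ?hornerN ?hornerC; ring. Qed.

Lemma vf2E f v : at_pt (vf2 f) v = p^`().[zc v] * at_pt (dx f) v + yc v * at_pt (dz f) v.
Proof. by rewrite /at_pt /= ?hornerX ?hornerC. Qed.

Lemma vf3E f v : at_pt (vf3 f) v = xc v * at_pt (dx f) v - yc v * at_pt (dy f) v.
Proof. by rewrite /at_pt /= ?hornerX ?horner0 ?hornerN ?hornerC; ring. Qed.

Lemma ham_tangent f v : yc v * at_pt (vf 0 f) v + xc v * at_pt (vf 1 f) v = p^`().[zc v] * at_pt
  (vf 2 f) v.
Proof. by rewrite vf1E vf2E vf3E; ring. Qed.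

(** The Jacobi identity: the commutator of two Hamiltonian fields is the field
    of the bracket. *)
Lemma jacobi f g v i : at_pt (vf i (poisson f g)) v =
  at_pt (dirv (ham f v) (vf i g)) v - at_pt (dirv (ham g v) (vf i f)) v.
Proof.
rewrite !at_pt_dirv /ham !xcE !ycE !zcE.
set x := xc v; set y := yc v; set z := zc v.
have cyx k : ev x y z (dy (dx k)) = ev x y z (dx (dy k)) := ev_difC _ _ _ _ _ _.
have czx k : ev x y z (dz (dx k)) = ev x y z (dx (dz k)) := ev_difC _ _ _ _ _ _.
have czy k : ev x y z (dz (dy k)) = ev x y z (dy (dz k)) := ev_difC _ _ _ _ _ _.
have X1 (t : K) : (('X : {poly K})^`()).[t] = 1 by rewrite derivX hornerC.
have Xt (t : K) : 'X.[t] = t := hornerX t.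
move: i; apply: ord3_case; rewrite /at_pt -/x -/y -/z /= !(cyx, czx, czy) ?derivC ?X1 ?Xt;
  move: (ev x y z (dx f)) (ev x y z (dy f)) (ev x y z (dz f)) => f1 f2 f3;
  move: (ev x y z (dx g)) (ev x y z (dy g)) (ev x y z (dz g)) => g1 g2 g3;
  move: (p^`()^`()) (p^`()) => p2 p1;
  rewrite ?horner0 ?(hornerC (-1)); ring.
Qed.

Lemma lu_cauchy_vf (F : nat -> pol) i : lu_cauchy F -> lu_cauchy (fun n => vf i (F n)).
Proof.
move=> hF; have h0 := lu_cauchy_dif 0 hF; have h1 := lu_cauchy_dif 1 hF;
  have h2 := lu_cauchy_dif 2 hF; move: i; apply: ord3_case.
- apply: lu_cauchy_mul; first exact: lu_cauchy_cst.
  by apply: lu_cauchy_add; apply: lu_cauchy_mul => //; exact: lu_cauchy_cst.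
- by apply: lu_cauchy_add; apply: lu_cauchy_mul => //; exact: lu_cauchy_cst.
- apply: lu_cauchy_add; first by apply: lu_cauchy_mul => //; exact: lu_cauchy_cst.
  apply: lu_cauchy_mul; first exact: lu_cauchy_cst.
  by apply: lu_cauchy_mul => //; exact: lu_cauchy_cst.
Qed.

Lemma lu_cauchy_poisson (F G : nat -> pol) : lu_cauchy F -> lu_cauchy G ->
  lu_cauchy (fun n => poisson (F n) (G n)).
Proof.
move=> hF hG; have h0 := lu_cauchy_dif 0 hG; have h1 := lu_cauchy_dif 1 hG;
  have h2 := lu_cauchy_dif 2 hG.
apply: lu_cauchy_add; first by apply: lu_cauchy_mul => //; exact: (lu_cauchy_vf 0 hF).
apply: lu_cauchy_add; first by apply: lu_cauchy_mul => //; exact: (lu_cauchy_vf 1 hF).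
by apply: lu_cauchy_mul => //; exact: (lu_cauchy_vf 2 hF).
Qed.

Section LimitHam.
Variable M : pol -> Prop.

(** Pointwise limits on D_p of Hamiltonian fields of polynomials that satisfy M
    and converge locally uniformly on C^3. *)
Definition lim_ham (V : Dsurf p -> 'rV[K]_3) := exists F : nat -> pol,
  [/\ lu_cauchy F, forall n, M (F n) &
      forall (q : Dsurf p) i, (fun n => at_pt (vf i (F n)) (set_val q)) @ \oo --> V q 0 i].

Lemma cvgC_unique (u : nat -> K) (a b : K) : u @ \oo --> a -> u @ \oo --> b -> a = b.
Proof.
move=> /cmod_cvg ha /cmod_cvg hb; apply/eqP; rewrite -subr_eq0; apply/negP => /negP ab.
have e0 : 0 < cmod (a - b) / 2 by rewrite divr_gt0 // cmod_gt0.
have [N hN] := ha _ e0; have [M' hM] := hb _ e0.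
have := hN (N + M')%N (leq_addr _ _); have := hM (N + M')%N (leq_addl _ _).
have := cmod_dist a b (u (N + M')%N); rewrite (cmodC a (u _)); lra.
Qed.

Lemma cvgC0 : (fun _ : nat => 0 : K) @ \oo --> (0 : K).
Proof. by apply/cmod_cvg => e e0; exists 0%N => n _; rewrite subrr cmod0. Qed.

Lemma lim_ham_tangent V (q : Dsurf p) : lim_ham V -> tangent p (set_val q) (V q).
Proof.
move=> [F [hF _ hV]]; set w := set_val q.
apply: (@cvgC_unique (fun n => yc w * at_pt (vf 0 (F n)) w + xc w * at_pt (vf 1 (F n)) w)).
  by apply: cvgD; apply: cvgMr; exact: hV.
rewrite (_ : (fun n => _) = fun n => p^`().[zc w] * at_pt (vf 2 (F n)) w).
  by apply: cvgMr; exact: hV.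
by apply/funext => n; exact: ham_tangent.
Qed.

(** The limit of the fields on the whole of C^3 extends V at every point, and
    its differential is computed termwise. *)
Lemma lim_ham_ext (V : Dsurf p -> 'rV[K]_3) (F : nat -> pol) : lu_cauchy F ->
  (forall (q : Dsurf p) i, (fun n => at_pt (vf i (F n)) (set_val q)) @ \oo --> V q 0 i) ->
  exists W : 'rV[K]_3 -> 'rV[K]_3, (forall q, local_extension V q W) /\
   forall v h i, (fun n => at_pt (dirv h (vf i (F n))) v) @ \oo --> 'd W v h 0 i.
Proof.
move=> hF hV; have [W [hW dW]] := lu_cauchy_limit (fun i => lu_cauchy_vf i hF).
exists W; split=> [q|v h i]; last by case: (dW v).
split; first by near=> v; case: (dW v).
near=> r; apply/rowP => i; apply: cvgC_unique (hV r i) (hW (set_val r) i).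
Unshelve. all: by end_near. Qed.

(** The derivative is linear in the direction, with convergent coefficients, so
    the direction may vary with n. *)
Lemma cvg_dirv (F G : nat -> pol) (v h : 'rV[K]_3) (i : 'I_3) (l : K) : lu_cauchy G ->
  (forall k, (fun n => at_pt (vf k (F n)) v) @ \oo --> h 0 k) ->
  (fun n => at_pt (dirv h (vf i (G n))) v) @ \oo --> l ->
  (fun n => at_pt (dirv (ham (F n) v) (vf i (G n))) v) @ \oo --> l.
Proof.
move=> hG hF hl; have hh d := lu_cauchy_dif d (lu_cauchy_vf i hG).
have [l1 c1] := lu_cauchy_cvg v (hh 0); have [l2 c2] := lu_cauchy_cvg v (hh 1);
  have [l3 c3] := lu_cauchy_cvg v (hh 2).
have -> : l = h 0 0 * l1 + h 0 1 * l2 + h 0 2 * l3.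
  apply: cvgC_unique hl _.
  rewrite (_ : (fun n => _) = fun n => xc h * at_pt (dx (vf i (G n))) v + yc h * at_pt (dy (vf i
    (G n))) v +
    zc h * at_pt (dz (vf i (G n))) v); last by apply/funext => n; rewrite at_pt_dirv.
  exact: (cvgD (cvgD (cvgMr c1) (cvgMr c2)) (cvgMr c3)).
rewrite (_ : (fun n => _) = fun n => at_pt (vf 0 (F n)) v * at_pt (dx (vf i (G n))) v +
   at_pt (vf 1 (F n)) v * at_pt (dy (vf i (G n))) v + at_pt (vf 2 (F n)) v * at_pt (dz (vf i (G
     n))) v).
  exact: (cvgD (cvgD (cvgM (hF 0) c1) (cvgM (hF 1) c2)) (cvgM (hF 2) c3)).
by apply/funext => n; rewrite at_pt_dirv /ham xcE ycE zcE.
Qed.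

Hypothesis sep : forall a, p.[a] = 0 -> p^`().[a] != 0.
Hypothesis M0 : M (QX 0).
Hypothesis Madd : forall f g, M f -> M g -> M (Add f g).
Hypothesis Mscale : forall a f, M f -> M (Mul (QZ a%:P) f).
Hypothesis Mpoisson : forall f g, M f -> M g -> M (poisson f g).

(** The bracket on D_p is computed from the extensions to C^3, hence is the
    limit of commutators of Hamiltonian fields, which are Hamiltonian by jacobi.
    *)
Lemma lim_ham_Lie_closed : Lie_closed (lim_ham : set (Dsurf p -> 'rV[K]_3)).
Proof.
split.
- exists (fun=> QX 0); split=> [|//|q i]; first exact: lu_cauchy_cst.
  rewrite mxE (_ : (fun _ => _) = (fun=> 0)); first exact: cvgC0.
  apply/funext => n; move: i; apply: ord3_case;
  rewrite /at_pt /= ?deriv0 ?hornerX ?horner0 ?(hornerC (-1)); ring.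
- move=> V W [F [hF MF cF]] [G [hG MG cG]]; exists (fun n => Add (F n) (G n)).
  split=> [|n|q i]; [exact: lu_cauchy_add|exact: Madd|].
  rewrite mxE (_ : (fun _ => _) = fun n => at_pt (vf i (F n)) (set_val q) + at_pt (vf i (G n))
    (set_val q)).
    exact: cvgD (cF q i) (cG q i).
  by apply/funext => n; move: i; apply: ord3_case;
    rewrite /at_pt /= ?hornerX ?horner0 ?hornerN ?hornerC; ring.
- move=> a V [F [hF MF cF]]; exists (fun n => Mul (QZ a%:P) (F n)).
  split=> [|n|q i]; [by apply: lu_cauchy_mul => //; exact: lu_cauchy_cst|exact: Mscale|].
  rewrite mxE (_ : (fun _ => _) = fun n => a * at_pt (vf i (F n)) (set_val q)).
    exact: cvgMr (cF q i).
  by apply/funext => n; move: i; apply: ord3_case;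
    rewrite /at_pt /= ?derivC ?hornerX ?horner0 ?hornerN ?hornerC; ring.
- move=> V W hV hW; have tV q := lim_ham_tangent q hV; have tW q := lim_ham_tangent q hW.
  case: hV hW => [F [hF MF cF]] [G [hG MG cG]].
  exists (fun n => poisson (F n) (G n)); split=> [|n|q i];
    [exact: lu_cauchy_poisson|exact: Mpoisson|].
  have [EV [eV dV]] := lim_ham_ext hF cF; have [EW [eW dW]] := lim_ham_ext hG cG.
  have -> : Lie_bracket V W q 0 i = 'd EW (set_val q) (V q) 0 i - 'd EV (set_val q) (W q) 0 i.
    apply: (etrans (coordB _ _ i)).
    exact: (congr2 (fun a b : 'rV[K]_3 => a 0 i - b 0 i) (tderive_ext sep (eW q) (tV q))
      (tderive_ext sep (eV q) (tW q))).
  rewrite (_ : (fun n => _) = fun n => at_pt (dirv (ham (F n) (set_val q)) (vf i (G n))) (set_val q)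
    - at_pt (dirv (ham (G n) (set_val q)) (vf i (F n))) (set_val q)); last first.
    by apply/funext => n; exact: jacobi.
  apply: cvgB.
    exact: (cvg_dirv hG (cF q) (dW _ _ _)).
  exact: (cvg_dirv hF (cG q) (dV _ _ _)).
Qed.

Hypothesis MX : forall s, M (QX s).
Hypothesis MY : forall s, M (QY s).

(** The Hamiltonian is a primitive of g in x, or its opposite in y, approximated
    as in entire_approx. *)
Lemma shear_lim_ham : shear_fields p `<=` (lim_ham : set (Dsurf p -> 'rV[K]_3)).
Proof.
move=> V [g eg hV]; have [P lP cP] := entire_approx eg.
case: hV => ->.
  exists (fun n => QX (P n)); split=> [|//|q i]; first exact: lu_cauchy_QX.
  set w := set_val q; move: i; apply: ord3_case; rewrite /shear_x -/w !mxE /=.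
  - rewrite mulr0 (_ : (fun _ => _) = (fun=> 0)); first exact: cvgC0.
    by apply/funext => n; rewrite vf1E /at_pt /= ?hornerX ?horner0 ?hornerN ?hornerC; ring.
  - rewrite mulrC (_ : (fun _ => _) = fun n => p^`().[zc w] * (P n)^`().[xc w]).
      exact: cvgMr (cP _).
    by apply/funext => n; rewrite vf2E /at_pt /= ?hornerX ?horner0 ?hornerN ?hornerC; ring.
  - rewrite mulrC (_ : (fun _ => _) = fun n => xc w * (P n)^`().[xc w]).
      exact: cvgMr (cP _).
    by apply/funext => n; rewrite vf3E /at_pt /= ?hornerX ?horner0 ?hornerN ?hornerC; ring.
exists (fun n => QY (- P n)); split=> [|//|q i].
  apply: lu_cauchy_QY => r e /(lP r)[N hN]; exists N => n m hn hm t ht.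
  by rewrite !hornerN -opprD cmodN; exact: hN.
set w := set_val q; move: i; apply: ord3_case; rewrite /shear_y -/w !mxE /=.
- rewrite mulrC (_ : (fun _ => _) = fun n => p^`().[zc w] * (P n)^`().[yc w]).
    exact: cvgMr (cP _).
  by apply/funext => n; rewrite vf1E /at_pt /= ?derivN ?hornerX ?horner0 ?hornerN ?hornerC; ring.
- rewrite mulr0 (_ : (fun _ => _) = (fun=> 0)); first exact: cvgC0.
  by apply/funext => n; rewrite vf2E /at_pt /= ?derivN ?hornerX ?horner0 ?hornerN ?hornerC; ring.
- rewrite mulrC (_ : (fun _ => _) = fun n => yc w * (P n)^`().[yc w]).
    exact: cvgMr (cP _).
  by apply/funext => n; rewrite vf3E /at_pt /= ?derivN ?hornerX ?horner0 ?hornerN ?hornerC; ring.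
Qed.

Theorem Lie_generated_lim_ham : Lie_generated (shear_fields p) `<=` (lim_ham : set (Dsurf p ->
  'rV[K]_3)).
Proof. exact: smallest_sub lim_ham_Lie_closed shear_lim_ham. Qed.

End LimitHam.
End Ham.

(** * Means over the circle action *)

Section Average.
Variable R : realType.
Local Notation K := (C R).
Local Notation pol := (pol R).
Variable p : {poly K}.
Implicit Types (f g : pol) (F G : K -> {poly K}) (P : {poly {poly K}}).

(** The mean of F over the unit circle: for a Laurent polynomial the means over
    all sufficiently large groups of roots of unity are equal. *)
Definition stable F (c : {poly K}) := exists N0, forall N z, (N0 < N)%N -> N.-primitive_root z ->
  N%:R^-1 *: (\sum_(0 <= k < N) F (z ^+ k)) = c.

Lemma natK_neq0 N0 N : (N0 < N)%N -> (N%:R : K) != 0.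
Proof. by move=> h; rewrite pnatr_eq0 gtn_eqF // (leq_ltn_trans _ h). Qed.

Lemma prim_neq0 N0 N (z : K) k : (N0 < N)%N -> N.-primitive_root z -> z ^+ k != 0.
Proof.
move=> hN pz; apply: expf_neq0; apply/eqP => h; have := prim_expr_order pz.
by rewrite h expr0n gtn_eqF ?(leq_ltn_trans _ hN) // => /eqP; rewrite eq_sym oner_eq0.
Qed.

Lemma stable_ext F G c : (forall x, x != 0 -> F x = G x) -> stable F c -> stable G c.
Proof.
move=> FG [N0 h]; exists N0 => N z hN pz; rewrite -(h N z hN pz); congr (_ *: _).
by apply: eq_bigr => k _; rewrite FG //; exact: prim_neq0 hN pz.
Qed.

Lemma stable_lin (a : K) F G c d : stable F c -> stable G d ->
  stable (fun x => a *: F x + G x) (a *: c + d).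
Proof.
move=> [N0 h0] [N1 h1]; exists (N0 + N1)%N => N z hN pz.
rewrite -(h0 N z _ pz) -?(h1 N z _ pz).
- by rewrite big_split /= -scaler_sumr scalerDr !scalerA mulrC.
- exact: leq_ltn_trans (leq_addl _ _) hN.
- exact: leq_ltn_trans (leq_addr _ _) hN.
Qed.

Lemma stableB F G c d : stable F c -> stable G d -> stable (fun x => F x - G x) (c - d).
Proof.
move=> hF hG; rewrite addrC -scaleN1r.
by apply: stable_ext (stable_lin (-1) hG hF) => x _; rewrite scaleN1r addrC.
Qed.

Lemma stable_deriv F c : stable F c -> stable (fun x => (F x)^`()) c^`().
Proof.
move=> [N0 h]; exists N0 => N z hN pz.
by rewrite -(h N z hN pz) derivZ (raddf_sum (@deriv K)).
Qed.

Lemma stable_inv F c : stable F c -> stable (fun x => F x^-1) c.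
Proof.
move=> [N0 h]; exists N0 => N z hN pz; rewrite -(h N _ hN (prim_rootV pz)).
by congr (_ *: _); apply: eq_bigr => k _; rewrite exprVn.
Qed.

Lemma stable_laurent P d : stable (fun x => x ^- d *: P.[x%:P]) P`_d.
Proof.
exists (size P + d)%N => N z hN pz.
have dN : (d < N)%N := leq_ltn_trans (leq_addl _ _) hN.
have nN : (size P <= N)%N := ltnW (leq_ltn_trans (leq_addr _ _) hN).
have := prim_fourier (fun i => P`_i) pz dN nN.
have -> : (if (d < size P)%N then P`_d else 0) = P`_d.
  by case: ltnP => // h; rewrite nth_default.
move=> h; apply: (scalerI (natK_neq0 hN)); rewrite scalerA divff ?(natK_neq0 hN) // scale1r -h.
apply: eq_bigr => k _; congr (_ *: _); rewrite horner_coef; apply: eq_bigr => i _.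
by rewrite mulrC -polyC_exp mul_polyC.
Qed.

(** F is a Laurent polynomial in x with coefficients polynomial in z, and G is
    its image under x d/dx. *)
Definition laurent F G := exists d P, forall x, x != 0 ->
  F x = x ^- d *: P.[x%:P] /\ G x = x ^- d *: ('X * P^`() - P *+ d).[x%:P].

(** A Laurent polynomial of the form x d/dx F has no constant term. *)
Lemma laurent_stable F G : laurent F G -> (exists c, stable F c) /\ stable G 0.
Proof.
move=> [d [P h]]; split.
  exists P`_d; apply: stable_ext (stable_laurent P d) => x /h[-> _] //.
have -> : 0 = ('X * P^`() - P *+ d)`_d.
  rewrite coefB coefMn coefXM coef_deriv; case: d {h} => [|d] /=; first by rewrite mulr0n subrr.
  by rewrite subrr.
by apply: stable_ext (stable_laurent _ d) => x /h[_ ->].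
Qed.

Lemma laurent_ext F G F' G' : (forall x, x != 0 -> F x = F' x) -> (forall x, x != 0 ->
  G x = G' x) ->
  laurent F G -> laurent F' G'.
Proof.
by move=> hF hG [d [P h]]; exists d, P => x x0; rewrite -hF // -hG //; exact: h.
Qed.

Lemma laurent_cst c : laurent (fun=> c) (fun=> 0).
Proof.
exists 0%N, c%:P => x x0; rewrite derivC mulr0 mulr0n subr0 horner0 hornerC expr0 invr1.
by rewrite !scale1r.
Qed.

Lemma laurent_x : laurent (fun x => x%:P) (fun x => x%:P).
Proof.
exists 0%N, 'X => x x0; rewrite derivX mulr0n subr0 mulr1 hornerX expr0 invr1.
by rewrite !scale1r.
Qed.

Lemma laurent_y : laurent (fun x => x^-1 *: p) (fun x => - (x^-1 *: p)).
Proof.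
exists 1%N, p%:P => x x0; rewrite derivC mulr0 mulr1n sub0r hornerN hornerC expr1.
by rewrite scalerN.
Qed.

Lemma laurentM F G F' G' : laurent F G -> laurent F' G' ->
  laurent (fun x => F x * F' x) (fun x => G x * F' x + F x * G' x).
Proof.
move=> [d [P h]] [d' [P' h']]; exists (d + d')%N, (P * P') => x x0.
have [-> ->] := h x x0; have [-> ->] := h' x x0.
have sc (A B : {poly K}) : x ^- d *: A * (x ^- d' *: B) = x ^- (d + d') *: (A * B).
  by rewrite -scalerAl -scalerAr scalerA exprD invfM.
rewrite !sc -scalerDr -!hornerM; split => //; congr (_ *: _).
rewrite -hornerD; congr (_.[_]).
by rewrite derivM mulrnDr; ring.
Qed.

Lemma laurentD F G F' G' : laurent F G -> laurent F' G' ->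
  laurent (fun x => F x + F' x) (fun x => G x + G' x).
Proof.
move=> [d [P h]] [d' [P' h']].
have shift e Q x : x != 0 -> x ^- e *: ('X^e * Q : {poly {poly K}}).[x%:P] = Q.[x%:P].
  move=> x0; rewrite hornerM hornerXn -polyC_exp mul_polyC scalerA mulVf ?scale1r //.
  exact: expf_neq0.
have XX e : 'X * ('X^e)^`() = 'X^e *+ e :> {poly {poly K}}.
  by case: e => [|e]; rewrite derivXn ?mulr0n ?mulr0 // mulrnAr -exprS.
exists (d + d')%N, ('X^d' * P + 'X^d * P') => x x0.
have [-> ->] := h x x0; have [-> ->] := h' x x0; split.
  rewrite hornerD scalerDr; congr (_ + _).
    by rewrite exprD invfM -scalerA shift.
  by rewrite addnC exprD invfM -scalerA shift.
have -> : 'X * ('X^d' * P + 'X^d * P')^`() - ('X^d' * P + 'X^d * P') *+ (d + d') =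
  'X^d' * ('X * P^`() - P *+ d) + 'X^d * ('X * P'^`() - P' *+ d').
  rewrite derivD !derivM.
  have -> : 'X * (('X^d')^`() * P + 'X^d' * P^`() + (('X^d)^`() * P' + 'X^d * P'^`())) =
    'X * ('X^d')^`() * P + 'X * ('X^d)^`() * P' + 'X^d' * ('X * P^`()) + 'X^d * ('X * P'^`()) by
      ring.
  by rewrite !XX; ring.
rewrite (hornerD ('X^d' * _)) [RHS]scalerDr; congr (_ + _).
  by rewrite exprD invfM -scalerA shift.
by rewrite addnC exprD invfM -scalerA shift.
Qed.

Lemma laurent_deriv F G : laurent F G -> laurent (fun x => (F x)^`()) (fun x => (G x)^`()).
Proof.
have DQ Q x : (Q.[x%:P])^`() = (map_poly (@deriv K) Q).[x%:P].
  rewrite [in LHS]horner_coef (horner_coef_wide _ (size_poly _ _)).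
  rewrite (raddf_sum (@deriv K)); apply: eq_bigr => i _.
  rewrite -polyC_exp; transitivity ((Q`_i)^`() * (x ^+ i)%:P).
    by apply: (etrans (derivM _ _)); rewrite derivC mulr0 addr0.
  by congr (_ * _); rewrite -[RHS]/((map_poly (@deriv K) Q)`_i) coef_map_id0 ?deriv0.
move=> [d [P h]]; exists d, (map_poly (@deriv K) P) => x x0.
have [-> ->] := h x x0; rewrite !derivZ !DQ; split => //; congr (_ *: _.[_]).
apply/polyP => i; rewrite coef_map_id0 ?deriv0 // !coefB !coefMn !coefXM !coef_deriv.
rewrite !coef_map_id0 ?deriv0 // derivB derivMn; congr (_ - _).
by case: ifP => _; rewrite ?deriv0 // derivMn.
Qed.

(** On D_p the function f is expressed in the coordinates x and z, with y = p(z)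
    / x. *)
Definition chart (x : K) f : {poly K} := evP x%:P (x^-1 *: p) 'X f.

(** The derivative x d/dx in the coordinates x and z, that is, along the circle
    action. *)
Definition weight f : pol := Add (Mul (QX 'X) (dx f)) (Mul (QZ (-1)%:P) (Mul (QY 'X) (dy f))).

Lemma chart_weight x f : chart x (weight f) = x%:P * chart x (dx f) - x^-1 *: p * chart x (dy f).
Proof. by rewrite /chart /= !comp_polyX comp_polyC polyCN mulNr mul1r. Qed.

Lemma laurent_comp F G (q : {poly K}) : laurent F G ->
  laurent (fun x => q \Po F x) (fun x => G x * (q^`() \Po F x)).
Proof.
move=> hF; elim/poly_ind: q => [|q c IH].
  apply: laurent_ext (laurent_cst 0) => x _; rewrite ?comp_poly0 //.
  by rewrite deriv0 comp_poly0 mulr0.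
apply: laurent_ext (laurentD (laurentM IH hF) (laurent_cst c%:P)) => x _.
  by rewrite comp_polyD comp_polyM comp_polyX comp_polyC.
rewrite derivD derivM derivX derivC !comp_polyD !comp_polyM comp_polyX comp_poly0.
by rewrite comp_polyC; ring.
Qed.

Lemma laurent_chart f : laurent (fun x => chart x f) (fun x => chart x (weight f)).
Proof.
elim: f => [q|q|q|f IHf g IHg|f IHf g IHg].
- apply: laurent_ext (laurent_comp q laurent_x) => x _ //.
  by rewrite chart_weight /chart /= comp_poly0 mulr0 subr0.
- apply: laurent_ext (laurent_comp q laurent_y) => x _ //.
  by rewrite chart_weight /chart /= comp_poly0 mulr0 sub0r mulNr.
- apply: laurent_ext (laurent_cst q) => x _; first by rewrite /chart /= comp_polyXr.
  by rewrite chart_weight /chart /= !comp_poly0 !mulr0 subr0.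
- apply: laurent_ext (laurentD IHf IHg) => x _ //.
  by rewrite !chart_weight /chart /=; ring.
- apply: laurent_ext (laurentM IHf IHg) => x _ //.
  by rewrite !chart_weight /chart /=; ring.
Qed.

Lemma deriv_chart x f : (chart x f)^`() = x^-1 *: p^`() * chart x (dy f) + chart x (dz f).
Proof. by rewrite /chart deriv_evP derivC derivZ derivX mul0r add0r mul1r. Qed.

(** In the coordinates x and z, with L = x d/dx, the bracket is (L f) g_z - f_z
    (L g), and this is the z-derivative of (L f) g minus L applied to f_z g. *)
Lemma chart_poisson x f g : x != 0 -> chart x (poisson p f g) =
  (chart x (weight f) * chart x g)^`() - ((chart x (weight f))^`() * chart x g + (chart x f)^`()
    * chart x (weight g)).
Proof.
move=> x0; rewrite derivM opprD addrACA subrr add0r !deriv_chart !chart_weight.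
rewrite /chart /= !comp_polyX !comp_polyXr polyCN.
move: (evP _ _ _ (dx f)) (evP _ _ _ (dy f)) (evP _ _ _ (dz f)) => f1 f2 f3.
move: (evP _ _ _ (dx g)) (evP _ _ _ (dy g)) (evP _ _ _ (dz g)) => g1 g2 g3.
have xx : x%:P * x^-1%:P = 1 :> {poly K} by rewrite -polyCM divff.
rewrite -!mul_polyC; move: (x%:P) (x^-1%:P) xx (p^`()) => X Y XY q.
transitivity (- (X * Y * q * f2 + X * f3) * g1 + ((X * Y * q * f1 + Y * p * f3) * g2 +
  (X * f1 + - (Y * p * f2)) * g3)); first by rewrite XY; ring.
by ring.
Qed.

(** The mean of f over the circle action is a constant plus the derivative of a
    polynomial that vanishes at the roots of p. This property separates the
    generated Lie algebra from the rotation field. *)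
Definition mean_exact f := exists (H : {poly K}) (c : K),
  (forall a, p.[a] = 0 -> H.[a] = 0) /\ stable (fun x => chart x f) (H^`() + c%:P).

Lemma mean_exact_lin a f g : mean_exact f -> mean_exact g ->
  mean_exact (Add (Mul (QZ a%:P) f) g).
Proof.
move=> [H [c [h s]]] [H' [c' [h' s']]]; exists (a *: H + H'), (a * c + c').
split=> [b pb|]; first by rewrite hornerD hornerZ h // h' // mulr0 addr0.
have -> : (a *: H + H')^`() + (a * c + c')%:P = a *: (H^`() + c%:P) + (H'^`() + c'%:P).
  by rewrite derivD derivZ polyCD polyCM mul_polyC scalerDr; ring.
apply: stable_ext (stable_lin a s s') => x _.
by rewrite /chart /= comp_polyC mul_polyC.
Qed.

Lemma mean_exact_ext f g : (forall x, x != 0 -> chart x f = chart x g) -> mean_exact f ->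
  mean_exact g.
Proof. by move=> fg [H [c [h s]]]; exists H, c; split => //; exact: stable_ext fg s. Qed.

Lemma mean_exact_X q : mean_exact (QX q).
Proof.
exists 0, q`_0; split=> [a _|]; first by rewrite horner0.
have := stable_laurent (map_poly polyC q) 0; rewrite coef_map_id0 // deriv0 add0r.
by apply: stable_ext => x _; rewrite expr0 invr1 scale1r.
Qed.

(** The symmetry exchanging x with 1 / x reduces the claim to polynomials in x.
    *)
Lemma mean_exact_Y q : mean_exact (QY q).
Proof.
exists 0, q`_0; split=> [a _|]; first by rewrite horner0.
have := stable_inv (stable_laurent (map_poly polyC q \Po ('X * p%:P)) 0).
rewrite -horner_coef0 horner_comp hornerM hornerX mul0r horner_coef0 coef_map_id0 //.
rewrite deriv0 add0r; apply: stable_ext => x _.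
by rewrite expr0 invr1 scale1r horner_comp hornerM hornerX hornerC mul_polyC.
Qed.

(** By chart_poisson the mean of the bracket is the derivative of the mean H of
    (L f) g. Over a root of p the circle may be taken in the curve y = 0, where
    (L f) g is divisible by x, so H is zero there. *)
Lemma mean_exact_poisson f g : mean_exact (poisson p f g).
Proof.
have Lf := laurent_chart (weight f); have Lf0 := laurent_chart f; have Lg := laurent_chart g.
have [[H hH] _] := laurent_stable (laurentM Lf Lg).
have [_ h0] := laurent_stable (laurentM (laurent_deriv Lf0) Lg).
exists H, 0; split=> [a pa|]; last first.
  rewrite -[_ + _]subr0 polyC0 addr0.
  apply: stable_ext (stableB (stable_deriv hH) h0) => x x0.
  by rewrite chart_poisson.
(* where y = 0 the function (weight f) g is x times a polynomial in x *)
pose S : {poly K} := 'X * evP 'X 0 a%:P (Mul (dx f) g).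
have hS x : (chart x (weight f) * chart x g).[a] = S.[x].
  rewrite hornerM chart_weight /S !(hornerD, hornerN, hornerM, hornerZ, hornerC, hornerX) pa.
  rewrite /chart !evP_horner !(hornerC, hornerX, hornerZ, horner0) pa mulr0 /=; ring.
have [N0 hN0] := hH.
have [N [z [hN pz _]]] := @primitive_roots R 1 (N0 + size S) ltr01.
have N0N := leq_ltn_trans (leq_addr _ _) hN.
rewrite -(hN0 N z N0N pz) hornerZ horner_sum.
under eq_bigr do rewrite hS.
have := @prim_fourier R K^o N 0 (size S) z (fun i => S`_i) pz (leq_ltn_trans (leq0n _) hN)
  (ltnW (leq_ltn_trans (leq_addl _ _) hN)).
rewrite [S`_0]coefXM eqxx if_same scaler0 => h.
rewrite [X in _ * X](_ : _ = 0) ?mulr0 //; apply: (etrans _ h); apply: eq_bigr => k _.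
rewrite expr0 invr1 scale1r horner_coef; apply: eq_bigr => i _.
by rewrite -[RHS]/((z ^+ k) ^+ i * S`_i) mulrC.
Qed.

End Average.

(** * The rotation field is not a limit *)

Section Final.
Variable R : realType.
Local Notation K := (C R).

(** The second divided difference of H + t^2 / 2 at the three points is that of
    t^2 / 2, hence not zero. On the other hand it kills affine functions, so it
    is controlled by the second derivative H'' + 1. *)
Lemma mean_gap (a1 a2 a3 : K) : a1 != a2 -> a1 != a3 -> a2 != a3 ->
  exists r e : R, 0 < e /\ forall H : {poly K}, H.[a1] = 0 -> H.[a2] = 0 -> H.[a3] = 0 ->
    ~ (forall t, cmod t <= r -> cmod ((H^`()^`()).[t] + 1) <= e).
Proof.
move=> a12 a13 a23.
pose s := cmod a1 + cmod a2 + cmod a3 + 1.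
have s0 : 0 < s by have := cmod_ge0 a1; have := cmod_ge0 a2; have := cmod_ge0 a3; rewrite /s; lra.
pose del := cmod ((a1 - a2) * (a1 - a3) * (a2 - a3)).
have del0 : 0 < del by rewrite cmod_gt0 // !mulf_neq0 // subr_eq0.
exists (2 * s), (del / (48 * s ^+ 3)); split.
  by rewrite divr_gt0 // mulr_gt0 // exprn_gt0.
move=> H h1 h2 h3 hb; set e := del / (48 * s ^+ 3) in hb.
pose G : {poly K} := H + (1 / 2) *: 'X^2.
have GE t : G.[t] = H.[t] + t ^+ 2 / 2 by rewrite /G hornerD hornerZ hornerXn; field.
have G2 : G^`()^`() = H^`()^`() + 1.
  rewrite /G !derivD !derivZ derivXn /= expr1 derivMn derivX; congr (_ + _).
  by apply/polyP => i; rewrite coefZ coefMn -mulr_natr; field.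
have cb m : cmod (G`_m.+2) * (2 * s) ^+ m <= e.
  have := @coef_bound R (G^`()^`()) (2 * s) e m (ltW (mulr_gt0 (ltr0Sn R 1) s0)).
  rewrite !coef_deriv => h; apply: le_trans (h _); last first.
    by move=> t ht; rewrite G2 hornerD hornerC; exact: hb.
  rewrite ler_wpM2r ?exprn_ge0 ?mulr_ge0 ?(ltW s0) //.
  rewrite -mulrnA -mulr_natr cmodM cmod_nat ler_peMr ?cmod_ge0 // ler1n.
  by rewrite muln_gt0.
have tail b : cmod b <= s -> cmod (G.[b] - G`_0 - G`_1 * b) <= 2 * e * s ^+ 2.
  move=> bs.
  have -> : G.[b] = \sum_(0 <= i < (size G).+2) G`_i * b ^+ i.
    by rewrite (@horner_coef_wide _ (size G).+2) ?big_mkord // (leq_trans (leqnSn _)).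
  rewrite 2?big_nat_recl // expr0 expr1 mulr1.
  set T := bigop _ _ _; have -> : G`_0 + (G`_1 * b + T) - G`_0 - G`_1 * b = T by ring.
  apply: (le_trans (cmod_sum _ _ _)).
  have e0 : 0 <= e by apply: le_trans (cb 0%N); rewrite expr0 mulr1 cmod_ge0.
  apply: (@le_trans _ _ (\sum_(0 <= i < size G) e * s ^+ 2 * (1 / 2) ^+ i)); last first.
    rewrite -mulr_sumr; have es : 0 <= e * s ^+ 2 by rewrite mulr_ge0 // sqr_ge0.
    have h2' : (0 : R) <= 1 / 2 by lra.
    by have := ler_wpM2l es (geom_le2 (size G) h2' (lexx _)); lra.
  apply: ler_sum => i _; rewrite cmodM cmodX.
  have bi : cmod b ^+ i.+2 <= s ^+ i.+2 by rewrite lerXn2r // nnegrE ?cmod_ge0 // ltW.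
  apply: (le_trans (ler_wpM2l (cmod_ge0 _) bi)).
  have -> : cmod G`_i.+2 * s ^+ i.+2 = cmod G`_i.+2 * (2 * s) ^+ i * (s ^+ 2 * (1 / 2) ^+ i).
    rewrite exprMn -[i.+2]addn2 exprD.
    have -> : cmod G`_(i + 2) * (2 ^+ i * s ^+ i) * (s ^+ 2 * (1 / 2) ^+ i) =
       cmod G`_(i + 2) * (s ^+ i * s ^+ 2) * (2 * (1 / 2)) ^+ i by rewrite [(2 * (1 / 2)) ^+
         i]exprMn; ring.
    have -> : 2 * (1 / 2) = 1 :> R by field.
    by rewrite expr1n mulr1.
  have -> : e * s ^+ 2 * (1 / 2) ^+ i = e * (s ^+ 2 * (1 / 2) ^+ i) by ring.
  by rewrite ler_wpM2r // mulr_ge0 ?sqr_ge0 // exprn_ge0 //; lra.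
have n1 : cmod a1 <= s by have := cmod_ge0 a2; have := cmod_ge0 a3; rewrite /s; lra.
have n2 : cmod a2 <= s by have := cmod_ge0 a1; have := cmod_ge0 a3; rewrite /s; lra.
have n3 : cmod a3 <= s by have := cmod_ge0 a1; have := cmod_ge0 a2; rewrite /s; lra.
(* the second divided difference of G, with denominators cleared *)
have key : (a1 - a2) * (a1 - a3) * (a2 - a3) =
   2 * ((a2 - a3) * (G.[a1] - G`_0 - G`_1 * a1) + (a3 - a1) * (G.[a2] - G`_0 - G`_1 * a2)
   + (a1 - a2) * (G.[a3] - G`_0 - G`_1 * a3)).
  by rewrite !GE h1 h2 h3; field.
have t1 := tail _ n1; have t2 := tail _ n2; have t3 := tail _ n3.
have d23 : cmod (a2 - a3) <= 2 * s by have := cmodB a2 a3; lra.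
have d31 : cmod (a3 - a1) <= 2 * s by have := cmodB a3 a1; lra.
have d12 : cmod (a1 - a2) <= 2 * s by have := cmodB a1 a2; lra.
have p1 := ler_pM (cmod_ge0 _) (cmod_ge0 _) d23 t1.
have p2 := ler_pM (cmod_ge0 _) (cmod_ge0 _) d31 t2.
have p3 := ler_pM (cmod_ge0 _) (cmod_ge0 _) d12 t3.
rewrite -!cmodM in p1 p2 p3.
(* three terms, each at most (2 s) (2 e s^2), and the factor 2 of key *)
have : del <= 24 * e * s ^+ 3.
  rewrite /del key cmodM cmod_nat.
  set q1 := (a2 - a3) * _ in p1 *; set q2 := (a3 - a1) * _ in p2 *; set q3 := (a1 - a2) * _ in p3 *.
  have := cmodD (q1 + q2) q3; have := cmodD q1 q2.
  have -> : 24 * e * s ^+ 3 = 6 * (2 * s * (2 * e * s ^+ 2)) by ring.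
  lra.
have -> : 24 * e * s ^+ 3 = del / 2.
  by rewrite /e; field; rewrite gt_eqF.
lra.
Qed.

Lemma three_roots (p : {poly K}) (n : nat) : size p = n.+1 -> (3 <= n)%N ->
  (forall a : K, root p a -> mup a p = 1%N) ->
  exists a1 a2 a3, [/\ p.[a1] = 0, p.[a2] = 0 & p.[a3] = 0] /\ [/\ a1 != a2, a1 != a3 & a2 != a3].
Proof.
move=> sp n3 hp.
have p0 : p != 0 by rewrite -size_poly_gt0 sp.
have [r hr] := closed_field_poly_normal p.
have lc0 : lead_coef p != 0 by rewrite lead_coef_eq0.
have sr : size r = n.
  have := size_prod_XsubC r (fun a : K => a).
  by rewrite -(size_scale (\prod_(a <- r) ('X - a%:P)) lc0) -hr sp; case.
have rr a : a \in r -> p.[a] = 0.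
  by move=> ar; rewrite hr hornerZ (rootP _) ?mulr0 // root_prod_XsubC.
have ur : uniq r.
  apply: count_mem_uniq => a; have [ar|ar] := boolP (a \in r); last by apply/count_memPn.
  have := hp a; rewrite (introT rootP (rr a ar)) => /(_ isT).
  rewrite {1}hr -mul_polyC mupMr ?mu_prod_XsubC // rootC //.
move: r sr ur rr {hr}; case=> [|a1 [|a2 [|a3 r]]]; rewrite /= => sr; rewrite -sr in n3 => //.
rewrite !inE !negb_or => /andP[/and3P[a12 a13 _] /andP[/andP[a23 _] _]] rr.
exists a1, a2, a3; split; last by split.
by split; apply: rr; rewrite !inE eqxx ?orbT.
Qed.

Variable p : {poly K}.

Lemma at_pt_continuous (f : pol R) : continuous (fun v : 'rV[K]_3 => at_pt f v : K).
Proof.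
have [W [hW dW]] := lu_cauchy_limit (fun _ : 'I_3 => lu_cauchy_cst f).
have -> : (fun v : 'rV[K]_3 => at_pt f v : K) = (fun M : 'rV[K]_3 => M 0 0 : K) \o W.
  apply/funext => v; apply: cvgC_unique (hW v 0).
  by apply/cmod_cvg => e e0; exists 0%N => n _; rewrite subrr cmod0.
move=> v; have cW := differentiable_continuous (dW v).1.
exact: (cvg_comp _ _ cW (@coord_continuous _ _ _ 0 0 (W v))).
Qed.

(** D_p is closed in C^3 and has the induced topology. *)
Lemma polydisc_compact (r : R) : compact [set q : Dsurf p | polydisc (set_val q) r].
Proof.
have cb : compact [set v : 'rV[K]_3 | forall i, [set z : K | cmod z <= r] (v ord0 i)].
  exact: (@rV_compact K 3 (fun=> [set z : K | cmod z <= r]) (fun i => @disc_compact R r)).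
pose f : pol R := Add (Mul (QX 'X) (QY 'X)) (QZ (- p)).
have fD v : at_pt f v = 0 <-> Dsurf p v.
  rewrite /at_pt /= !hornerX hornerN /Dsurf /=; split=> [/eqP|->]; last by rewrite subrr.
  by rewrite subr_eq0 => /eqP.
move=> F FF FK.
have FF' : ProperFilter (set_val @ F) by exact: fmap_proper_filter.
have [v [hv cv]] := cb (set_val @ F) FF' FK.
have Dv : Dsurf p v.
  apply/fD; apply/eqP; apply/negP => /negP fv.
  have nv : nbhs v [set w : 'rV[K]_3 | at_pt f w != 0].
    exact: cvg_neq0 (@at_pt_continuous f v) fv.
  have [w [/= [q _ <-]]] := cv (set_val @` [set: Dsurf p]) _ (filterS (fun q _ => ex_intro2 _ _
    q I erefl) filterT) nv.
  by move=> /eqP; apply; apply/fD; exact: Dsurf_val.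
have [q hq] := DsurfP Dv.
exists q; split; first by move=> i; rewrite hq; exact: hv.
move=> A B FA /near_Dsurf[B' nB' hB'].
have FA' : F (set_val @^-1` (set_val @` A : set 'rV[K]_3)).
  by apply: filterS FA => a Aa; exists a.
rewrite hq in nB'.
have [w [[a Aa aw] B'w]] := cv _ _ FA' nB'.
by exists a; split => //; apply: hB'; rewrite aw.
Qed.

Lemma dense_approx (A B : set (Dsurf p -> 'rV[K]_3)) V r (e : R) : co_dense A B -> B V -> 0 < e ->
  exists2 W, A W & forall q : Dsurf p, polydisc (set_val q) r -> cmod (W q 0 0 - V q 0 0) <= e.
Proof.
move=> AB BV e0; have cV := AB V BV.
have eE : entourage [set xy : 'rV[K]_3 * 'rV[K]_3 | ball xy.1 (rc e) xy.2].
  by rewrite -entourage_ballE; exists (rc e); rewrite /= ?rc_gt0.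
have := fam_nbhs V eE (@polydisc_compact r) => /cV[W [AW hW]].
exists W => // q hq; have := hW q hq; rewrite /= -ball_normE /ball_ /= nvE rc_lt => h.
have := (nv_polydisc _ (nv_ge0 _)).1 (lexx (nv (V q - W q))) 0.
by rewrite !mxE cmodC => h'; apply: le_trans h' (ltW h).
Qed.

Lemma lim_ham_approx (M : pol R -> Prop) V r (e : R) : lim_ham M V -> 0 < e ->
  exists2 f, M f & forall q : Dsurf p, polydisc (set_val q) r ->
    cmod (at_pt (vf p 0 f) (set_val q) - V q 0 0) <= e.
Proof.
move=> [F [hF MF cF]] e0; have [N hN] := lu_cauchy_vf p 0 hF r e0.
exists (F N); first exact: MF.
move=> q hq; apply: (@cvg_le _ (fun n => at_pt (vf p 0 (F N)) (set_val q) - at_pt (vf p 0 (F n))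
  (set_val q)) _ _ N).
  apply: cvgB; last exact: cF.
  by apply/cmod_cvg => d d0; exists 0%N => n _; rewrite subrr cmod0.
by move=> n hn; exact: hN.
Qed.

(** Along the points (x, p(t) / x, t) the quotient of the first component of the
    field of f by x is minus the t-derivative of chart x f, and its mean over
    |x| = 1 is - H''(t). For the rotation field the quotient is 1, so closeness
    on a polydisc containing these points forces H'' to be close to -1, against
    mean_gap. *)
Lemma mean_exact_far (a1 a2 a3 : K) : [/\ p.[a1] = 0, p.[a2] = 0 & p.[a3] = 0] ->
  [/\ a1 != a2, a1 != a3 & a2 != a3] ->
  exists r e : R, 0 < e /\ forall f, mean_exact p f ->
   ~ (forall q : Dsurf p, polydisc (set_val q) r ->
     cmod (at_pt (vf p 0 f) (set_val q) - rot_field q 0 0) <= e).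
Proof.
move=> [pa1 pa2 pa3] [a12 a13 a23].
have [r [e [e0 he]]] := mean_gap a12 a13 a23.
have [B B0 hB] := poly_bounded p r.
exists (1 + B + `|r|), e; split => // f [H [c [hH [N0 hs]]]] hf.
apply: (he H (hH _ pa1) (hH _ pa2) (hH _ pa3)) => t ht.
have [N [z [hN pz _]]] := @primitive_roots R 1 N0 ltr01.
have Np : (0 < N)%N := leq_ltn_trans (leq0n _) hN.
have nz k : cmod (z ^+ k) = 1 by rewrite cmodX (cmod_unit_root Np (prim_expr_order pz)) expr1n.
have NK := natK_neq0 R hN.
have -> : (H^`()^`()).[t] + 1 = N%:R^-1 * \sum_(0 <= k < N) (((chart p (z ^+ k) f)^`()).[t] + 1).
  rewrite big_split /= sumr_const_nat subn0 mulrDr mulVf //; congr (_ + _).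
  have -> : H^`()^`() = (H^`() + c%:P)^`() by rewrite derivD derivC addr0.
  by rewrite -(hs N z hN pz) derivZ hornerZ (raddf_sum (@deriv K)) horner_sum.
rewrite cmodM cmodV cmod_nat ler_pdivrMl ?ltr0n //.
apply: (le_trans (cmod_sum _ _ _)).
have -> : N%:R * e = \sum_(0 <= k < N) e by rewrite sumr_const_nat subn0 mulr_natl.
apply: ler_sum => k _.
have zk : z ^+ k != 0 := prim_neq0 k hN pz.
pose w : 'rV[K]_3 := vec3 (z ^+ k) ((z ^+ k)^-1 * p.[t]) t.
have [q hq] : exists q : Dsurf p, set_val q = w.
  by apply: DsurfP; rewrite /Dsurf /= xcE ycE zcE mulrA divff // mul1r.
have hqr : polydisc (set_val q) (1 + B + `|r|).
  have r0 := normr_ge0 r.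
  rewrite hq; apply: ord3_case; rewrite mxE /= ?cmodM ?cmodV ?nz ?invr1 ?mul1r.
  - lra.
  - by have := hB t ht; lra.
  - by have := ler_norm r; lra.
have := hf q hqr; rewrite /rot_field rotE hq vf1E xcE zcE [sg _ 0]/(1 : K) mul1r mxE /=.
have -> : (chart p (z ^+ k) f)^`().[t] + 1 = - (z ^+ k)^-1 *
  (- (p^`().[t] * at_pt (dy f) w + z ^+ k * at_pt (dz f) w) - z ^+ k).
  rewrite deriv_chart hornerD hornerM hornerZ /chart !evP_horner hornerC hornerZ hornerX.
  by rewrite /at_pt xcE ycE zcE; field.
by rewrite cmodM cmodN cmodV nz invr1 mul1r.
Qed.

End Final.

Theorem corollary3p15 (R : realType) (p : {poly C R}) (n : nat)
    (degp : size p = n.+1) (n_ge3 : (3 <= n)%N)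
    (simple_zeros : forall a : C R, root p a -> mup a p = 1%N) :
  ~ co_dense (Lie_generated (shear_fields p)) (volume_preserving p).
Proof.
have p0 : p != 0 by rewrite -size_poly_gt0 degp.
have sep a : p.[a] = 0 -> p^`().[a] != 0 by exact: root_deriv_neq0.
have [a1 [a2 [a3 [roots dist]]]] := three_roots degp n_ge3 simple_zeros.
have [r [e [e0 far]]] := mean_exact_far roots dist.
have e2 : 0 < e / 2 by rewrite divr_gt0.
move=> dense.
have [V LV hV] := dense_approx r dense (rot_field_volume_preserving sep) e2.
have SV : lim_ham (mean_exact p) V.
  apply: (Lie_generated_lim_ham sep _ _ _ _ _ _ LV).
  - exact: mean_exact_X.
  - move=> f g hf hg; apply: mean_exact_ext (mean_exact_lin 1 hf hg) => x _.
    by rewrite /chart /= comp_polyC mul1r.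
  - move=> a f hf; apply: mean_exact_ext (mean_exact_lin a hf (mean_exact_X p 0)) => x _.
    by rewrite /chart /= comp_poly0 addr0.
  - by move=> f g _ _; exact: mean_exact_poisson.
  - exact: mean_exact_X.
  - exact: mean_exact_Y.
have [f Mf hf] := lim_ham_approx r SV e2.
apply: (far f Mf) => q hq; have := hf q hq; have := hV q hq.
have := cmod_dist (at_pt (vf p 0 f) (set_val q)) (rot_field q 0 0) (V q 0 0); lra.
Qed.
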